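(* Let $r\ge 2$ be an integer. For each prime $p$, let $k_p$ be a perfect field of characteristic $p$, let $R_p=k_p[x,y]_{\langle x,y\rangle}$, and let $f_p\in k_p[x,y]$ be a product of $r$ distinct (pairwise non-proportional) homogeneous linear forms, for every prime $p$ for which such a product exists over $k_p$ (in particular for all large $p$). Let $c_p=\mathrm{FPT}(f_p)$ be the F-pure threshold of $f_p$ in $R_p$. Then the F-signature functions $t\mapsto s(R_p,f_p^t)$ converge uniformly on the interval $[0,c_p]$ to the polynomial $\frac{r^2}{4}t^2-rt+1$ as $p\to\infty$, that is, $$\lim_{p\to\infty}\ \sup_{t\in[0,c_p]}\left|\,s(R_p,f_p^t)-\left(\frac{r^2}{4}t^2-rt+1\right)\right|=0.$$
   Context: Let $(R,\mathfrak m)$ be an F-finite regular local ring of characteristic $p$ and dimension $d$ (here $R=R_p$, $\mathfrak m=\langle x,y\rangle R_p$, $d=2$), and $f\in R$ nonzero. For an ideal $I\subseteq R$, $I^{[p^e]}$ is the ideal generated by all $p^e$-th powers of elements of $I$; $\ell_R$ denotes length. F-signature of the pair $(R,f^t)$, for real $t\ge0$: $$s(R,f^t)=\lim_{e\to\infty}\frac1{p^{ed}}\ell_R\!\left(\frac{R}{\mathfrak m^{[p^e]}:f^{\lceil t(p^e-1)\rceil}}\right).$$ F-pure threshold: $\mathrm{FPT}(f)$ is the supremum of all $t\ge 0$ such that the pair $(R,f^t)$ is F-pure; equivalently, the supremum of all $t\ge 0$ such that $f^{\lceil t(p^e-1)\rceil}\notin\mathfrak m^{[p^e]}$ for some $e>0$.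 *)

(* Defs.v *)
From HB Require Import structures.
From mathcomp Require Import all_boot all_order all_algebra.
From mathcomp Require Import mpoly.
From mathcomp Require Import boolp classical_sets reals constructive_ereal.
From mathcomp Require Import ereal topology normedtype sequences.

Set Implicit Arguments.
Unset Strict Implicit.
Unset Printing Implicit Defensive.

Import Order.TTheory GRing.Theory Num.Theory.

Local Open Scope classical_set_scope.
Local Open Scope ring_scope.

Section QuotientModule.
Local Open Scope quotient_scope.
Variables (A : nzRingType) (V : lmodType A) (N : submodClosed V).

(* [submodClosed] does not inherit from [zmodClosed] in the hierarchy, which
   the quotient construction of ring_quotient requires. *)
Definition submod_zmod_pred : {pred V} := [pred v | v \in N].

Fact submod_zmod_closed : zmod_closed submod_zmod_pred.
Proof. exact: (GRing.submod_closedB (GRing.submodClosedP N)). Qed.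

HB.instance Definition _ :=
  GRing.isZmodClosed.Build V submod_zmod_pred submod_zmod_closed.

Definition quotient_module : Type := Quotient.quot submod_zmod_pred.

HB.instance Definition _ := GRing.Zmodule.on quotient_module.
HB.instance Definition _ := EqQuotient.on quotient_module.

Definition quotient_scale (a : A) : quotient_module -> quotient_module :=
  lift_op1 quotient_module ( *:%R a).

Lemma pi_quotient_scale a :
  {morph \pi_quotient_module : v / a *: v >-> quotient_scale a v}.
Proof.
move=> v; unlock quotient_scale; apply/eqP.
rewrite -(Quotient.idealrBE submod_zmod_pred) -scalerBr inE rpredZ //.
have := Quotient.idealrBE submod_zmod_pred v (repr (\pi_quotient_module v)).
by rewrite inE => ->; rewrite reprK.
Qed.

Lemma pi_quotientD : {morph \pi_quotient_module : u v / u + v}.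
Proof. exact: (raddfD (\pi_(Quotient.quot submod_zmod_pred))). Qed.

Fact quotient_scaleA a b v :
  quotient_scale a (quotient_scale b v) = quotient_scale (a * b) v.
Proof. by elim/quotW: v => v; rewrite -!pi_quotient_scale scalerA. Qed.

Fact quotient_scale1 : left_id 1 quotient_scale.
Proof. by move=> v; elim/quotW: v => v; rewrite -pi_quotient_scale scale1r. Qed.

Fact quotient_scaleDr : right_distributive quotient_scale +%R.
Proof.
move=> a u v; elim/quotW: u => u; elim/quotW: v => v.
by rewrite -pi_quotientD -!pi_quotient_scale -pi_quotientD scalerDr.
Qed.

Fact quotient_scaleDl v : {morph quotient_scale^~ v : a b / a + b}.
Proof.
move=> a b; elim/quotW: v => v.
by rewrite -!pi_quotient_scale -pi_quotientD scalerDl.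
Qed.

HB.instance Definition _ := GRing.Zmodule_isLmodule.Build A quotient_module
  quotient_scaleA quotient_scale1 quotient_scaleDr quotient_scaleDl.

End QuotientModule.

Definition mod_length (R : realType) (A : nzRingType) (M : lmodType A) : \bar R :=
  ereal_sup [set n%:R%:E | n in [set n : nat |
    exists N : nat -> submodClosed M,
      forall i, (i < n)%N -> [set` N i] `<` [set` N i.+1]]].

(* The ideals of [A] are the submodules of the regular module [A^o]; unlike
   the [idealr] of ring_quotient they may be improper. *)
Notation ideal A := (submodClosed A^o).

Section Ideals.
Variable A : comNzRingType.

Definition ideal_gen (S : set A) : {pred A^o} := [pred a : A^o |
  `[< exists n (c g : 'I_n -> A),
        (forall i, S (g i)) /\ (a : A) = \sum_(i < n) c i * g i >]].

Fact ideal_gen_submod_closed (S : set A) : submod_closed (ideal_gen S).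
Proof.
split.
  apply/asboolP; exists 0%N, (fun=> 0), (fun=> 0).
  by split; [case | rewrite big_ord0].
move=> a u v /asboolP[n [c [g [Sg ->]]]] /asboolP[n' [c' [g' [Sg' ->]]]].
apply/asboolP; exists (n + n')%N.
exists (fun i => match split i with inl j => a * c j | inr j => c' j end).
exists (fun i => match split i with inl j => g j | inr j => g' j end).
split=> [i|]; first by case: (split i).
rewrite big_split_ord [a *: _]mulr_sumr; congr (_ + _); apply: eq_bigr => i _.
  by rewrite (unsplitK (inl i)) mulrA.
by rewrite (unsplitK (inr i)).
Qed.

HB.instance Definition _ (S : set A) := GRing.isSubmodClosed.Build A A^o
  (ideal_gen S) (GRing.submod_closed_semi (ideal_gen_submod_closed S)).

Definition colon (I : ideal A) (x : A) : {pred A^o} :=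
  [pred a : A^o | (a : A) * x \in I].

Fact colon_submod_closed (I : ideal A) (x : A) : submod_closed (colon I x).
Proof.
split=> [|a u v]; rewrite !inE; first by rewrite mul0r; exact: rpred0.
by move=> Iu Iv; rewrite mulrDl -mulrA; apply: rpredD => //; apply: rpredZ.
Qed.

HB.instance Definition _ (I : ideal A) (x : A) :=
  GRing.isSubmodClosed.Build A A^o (colon I x)
    (GRing.submod_closed_semi (colon_submod_closed I x)).

Definition frobenius_power (I : ideal A) (q : nat) : ideal A :=
  ideal_gen [set a ^+ q | a in [set` I]].

End Ideals.

Section Localization.
Variables (D : idomainType) (P : prime_idealr D).
Local Notation "a %:F" := (@FracField.tofrac D a).

Definition local_pred : {pred {fraction D}} := [pred z |
  `[< exists a b : D, b \notin P /\ z = a%:F / b%:F >]].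

Fact local_subring_closed : subring_closed local_pred.
Proof.
have nz (b : D) : b \notin P -> b%:F != 0.
  by rewrite tofrac_eq0; apply: contraNneq => ->; exact: idealr0.
have nP (b c : D) : b \notin P -> c \notin P -> b * c \notin P.
  by move=> Pb Pc; rewrite prime_idealrM negb_or Pb.
split.
- apply/asboolP; exists 1, 1; split; first by rewrite idealr1.
  by rewrite divff // nz // idealr1.
- move=> _ _ /asboolP[a [b [Pb ->]]] /asboolP[c [e [Pe ->]]].
  apply/asboolP; exists (a * e - c * b), (b * e); split; first exact: nP.
  by rewrite -mulNr addf_div ?nz // -tofracN -!tofracM -tofracD mulNr.
- move=> _ _ /asboolP[a [b [Pb ->]]] /asboolP[c [e [Pe ->]]].
  apply/asboolP; exists (a * c), (b * e); split; first exact: nP.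
  by rewrite mulf_div !tofracM.
Qed.

HB.instance Definition _ :=
  GRing.isSubringClosed.Build {fraction D} local_pred local_subring_closed.

(* The localization D_P, as a subring of the fraction field of D *)
Record localization := Localization {
  local_val : {fraction D};
  local_valP : local_val \in local_pred }.

HB.instance Definition _ := [isSub for local_val].
HB.instance Definition _ := [Choice of localization by <:].
HB.instance Definition _ := [SubChoice_isSubComNzRing of localization by <:].

Fact tofrac_local (a : D) : a%:F \in local_pred.
Proof.
apply/asboolP; exists a, 1; split; first by rewrite idealr1.
by rewrite tofrac1 divr1.
Qed.

Definition to_local (a : D) : localization := Localization (tofrac_local a).

End Localization.

Section Fsingularities.
Variable R : realType.
Variables (p : nat) (A : comNzRingType).

(* The absolute value only casts int to nat: the ceiling is nonnegative
   whenever t is. *)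
Definition ceil_exponent (t : R) (e : nat) : nat :=
  `|Num.ceil (t * (p%:R ^+ e - 1))|%N.

Definition Fsignature (d : nat) (m : ideal A) (f : A) (t : R) : \bar R :=
  lim ((fun e : nat =>
    mod_length R
      (quotient_module (colon (frobenius_power m (p ^ e)) (f ^+ ceil_exponent t e)))
    * ((p%:R ^+ (e * d))^-1)%:E)%E @ \oo).

(* A map phi as below is an [A]-linear map F^e_* A -> A; F-purity asks one of
   them to split the map A -> F^e_* A, 1 |-> F^e_* f^(ceil (t (p^e - 1))).
   For F-finite A, purity of that map is the same as its splitting. *)
Definition Fpure (f : A) (t : R) : Prop :=
  exists2 e : nat, (0 < e)%N & exists phi : A -> A,
    [/\ forall a b, phi (a + b) = phi a + phi b,
        forall a b, phi (a ^+ (p ^ e) * b) = a * phi b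
      & phi (f ^+ ceil_exponent t e) = 1].

Definition Fpure_threshold (f : A) : \bar R :=
  ereal_sup [set t%:E | t in [set t : R | 0 <= t /\ Fpure f t]].

End Fsingularities.

Section Plane.
Variable k : fieldType.

Definition perfect_in_char (p : nat) : Prop :=
  p \in [pchar k] /\ forall a : k, exists b : k, b ^+ p = a.

Definition xy_ideal : {pred {mpoly k[2]}} :=
  ideal_gen [set 'X_i | i in [set: 'I_2]].

Fact xy_idealE (g : {mpoly k[2]}) : (g \in xy_ideal) = (g@_0%MM == 0).
Proof.
apply/idP/eqP.
  case/asboolP => n [c [h [hX ->]]]; rewrite raddf_sum big1 // => i _.
  have [j _ <-] := hX i; rewrite /=.
  by rewrite rmorphM /= mcoeffX mnm1_eq0 mulr0.
move=> g0; rewrite [g]mpolyE big_seq; apply: rpred_sum => m.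
rewrite mcoeff_msupp => gm.
have [i mi] : exists i, m i != 0%N.
  apply/existsP; apply: contraNT gm; rewrite negb_exists => /forallP m0.
  suff -> : m = 0%MM by rewrite g0.
  by apply/mnmP => i; rewrite mnmE; apply/eqP; have := m0 i; rewrite negbK.
have le_im : (U_(i) <= m)%MM by rewrite lep1mP.
rewrite -(submK le_im) mpolyXD -mul_mpolyC mulrA.
apply/asboolP; exists 1%N.
exists (fun=> (g@_(m - U_(i) + U_(i)))%:MP * 'X_[m - U_(i)]), (fun=> 'X_i).
by split=> [_|]; [exists i | rewrite big_ord1].
Qed.

Fact xy_ideal_idealr_closed : idealr_closed xy_ideal.
Proof.
split=> [||a u v]; rewrite !xy_idealE ?mcoeff0 ?mcoeff1 ?eqxx ?oner_eq0 //.
by move=> /eqP u0 /eqP v0; rewrite mcoeffD rmorphM /= u0 v0 mulr0 addr0.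
Qed.

Fact xy_ideal_prime_closed : prime_idealr_closed xy_ideal.
Proof. by move=> u v; rewrite !xy_idealE rmorphM /= mulf_eq0. Qed.

HB.instance Definition _ :=
  isIdealr.Build {mpoly k[2]} xy_ideal xy_ideal_idealr_closed.
HB.instance Definition _ :=
  isPrimeIdealrClosed.Build {mpoly k[2]} xy_ideal xy_ideal_prime_closed.

Definition plane_local_ring : comNzRingType := localization xy_ideal.

Definition plane_local (g : {mpoly k[2]}) : plane_local_ring :=
  to_local xy_ideal g.

Definition plane_max_ideal : ideal plane_local_ring :=
  ideal_gen [set plane_local 'X_i | i in [set: 'I_2]].

(* Taking c = 0 below, the forms are nonzero as soon as r >= 2. *)
Definition product_of_forms (r : nat) (g : {mpoly k[2]}) : Prop :=
  exists L : 'I_r -> {mpoly k[2]},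
    [/\ forall i, L i \is 1.-homog,
        forall i j, i != j -> forall c : k, L i != c *: L j
      & g = \prod_(i < r) L i].

End Plane.

(* Main.v *)
Require Import Defs.
From HB Require Import structures.
From mathcomp Require Import all_boot all_order all_algebra.
From mathcomp Require Import mpoly.
From mathcomp Require Import boolp classical_sets reals constructive_ereal.
From mathcomp Require Import ereal topology normedtype sequences.
From mathcomp Require Import zify ring lra.

(** Write S = k[x,y], q = p^e and N = ceil (t (q - 1)).  The length of
    R / (m^[q] : f^N) is the rank lambda(q,N) of multiplication by f^N on
    S / (x^q, y^q), and s(R, f^t) is the limit of lambda(q,N) / q^2.

    Ranks are counted by initial monomials: [initials q g] is the set of lowest
    monomials, modulo (x^q, y^q), of the multiples of g.  A chain of submodules
    of R / (m^[q] : g) gives a strictly increasing chain of sets of such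
    monomials, and the monomial ideals of a lexicographic filtration cut out a
    chain of maximal length ([length_initials]).  In this form two facts are
    purely combinatorial: lambda(pq, pN) = p^2 lambda(q, N), because k is
    perfect ([card_initials_Frobenius]), and
    0 <= lambda(q,N) - lambda(q,N+1) <= r q ([card_initials_mul]).  Together they
    make the sequence lambda(q,N) / q^2 converge, to a limit that differs from
    lambda(p,n) / p^2, where n = floor (t p), by at most r / p.

    It remains to see that lambda(p,n) = (p - r n / 2)^2 + O(p) when r n <= 2 p,
    since (1 - r t / 2)^2 is the expected polynomial.  In each degree the rank of
    multiplication by f^n is at most the smaller of the two dimensions, and these
    minima add up to at most (p - r n / 2)^2 ([card_initials_homogeneous_le]).
    For the converse ([card_initials_homogeneous_ge]) it suffices that the
    multiplication be injective in all degrees j < p - r n / 2 - O(1): the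
    matrix is of Hankel type, so injectivity in low degrees transposes to
    surjectivity in high degrees.

    Injectivity ([band_neq0]) is a Wronskian argument.  If s f^n = A x^p + B y^p
    then derivations see x^p and y^p as constants, so f^(n-1) divides
    A' B - A B', whose degree is too small for that unless it vanishes.  Then A
    and B, being of degree less than p, are constant multiples of one form g, so
    s f^n = g l^p with l a linear form because k is perfect.  As f has no
    multiple factor, l^(p-n) divides s, against the bound on deg s.

    The F-pure threshold enters through two inequalities only.  It is at most
    2 / r, as f^N lies in m^[q] once r N > 2 q - 2; and it is nonnegative, as
    the Frobenius map of R splits, so the supremum is over a nonempty set of
    parameters in [0, 2/r], on which the error is at most 3 r / p. *)

Set Implicit Arguments.
Unset Strict Implicit.
Unset Printing Implicit Defensive.

Import Order.TTheory GRing.Theory Num.Theory.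
Import numFieldNormedType.Exports.

Local Open Scope ring_scope.

(** * Initial monomials modulo (x^q, y^q) *)

(** The outer variable is x and the inner one y: the coefficient of x^a y^b
    in u is u`_a`_b. *)
Notation bipoly K := {poly {poly K}}.

(** The position a q + b orders the exponents below q lexicographically. *)
Lemma ltn_index q a b a' b' : (b < q)%N -> (b' < q)%N ->
  (a * q + b < a' * q + b')%N = ((a < a') || (a == a') && (b < b'))%N.
Proof.
move=> bq b'q; case: (ltngtP a a') => [lt|lt|->] /=; last by rewrite ltn_add2l.
- by nia.
- by apply/negbTE; rewrite -leqNgt; nia.
Qed.

Lemma card_ord_geq q c : (#|[set i : 'I_q | (q - c <= i)%N]| <= c)%N.
Proof.
have := @big_geq_mkord _ 0%N addn (q - c) q xpredT (fun=> 1%N).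
by rewrite /= sum1dep_card sum_nat_const_nat => <-; lia.
Qed.

Section Initials.
Variable K : fieldType.
Implicit Types (s u v g : bipoly K) (q T a b : nat).

(** For T = q^2 this says that u lies in (x^q, y^q); the intermediate values of
    T give a filtration by monomial ideals with one-dimensional steps. *)
Definition vanishes_below q T u := forall a b,
  (a < q)%N -> (b < q)%N -> (a * q + b < T)%N -> u`_a`_b = 0.

Definition initial_at q u a b :=
  u`_a`_b != 0 /\ vanishes_below q (a * q + b) u.

Definition initials q g : {set 'I_q * 'I_q} :=
  [set ab : 'I_q * 'I_q | `[< exists s, initial_at q (s * g) ab.1 ab.2 >]].

Lemma coefM2 u v a b :
  (u * v)`_a`_b = \sum_(i < a.+1) \sum_(j < b.+1) u`_i`_j * v`_(a - i)`_(b - j).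
Proof. by rewrite coefM coef_sum; apply: eq_bigr => i _; rewrite coefM. Qed.

Lemma vanishes_belowD q T u v :
  vanishes_below q T u -> vanishes_below q T v -> vanishes_below q T (u + v).
Proof.
by move=> u0 v0 a b aq bq abT; rewrite !coefD u0 // v0 // addr0.
Qed.

Lemma vanishes_below_mull q T s u :
  vanishes_below q T u -> vanishes_below q T (s * u).
Proof.
move=> u0 a b aq bq abT; rewrite coefM2 big1 // => i _; rewrite big1 // => j _.
rewrite u0 ?mulr0 //; [lia|lia|].
by apply: leq_ltn_trans abT; rewrite leq_add ?leq_mul ?leq_subr.
Qed.

Lemma vanishes_below_le q T1 T2 u :
  (T1 <= T2)%N -> vanishes_below q T2 u -> vanishes_below q T1 u.
Proof. by move=> le12 u0 a b aq bq /leq_trans/(_ le12); apply: u0. Qed.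

(** Multiplying by s scales the initial term by the constant term of s: every
    other contribution involves a smaller monomial of u. *)
Lemma coefM_initial q s u a b : (a < q)%N -> (b < q)%N ->
  vanishes_below q (a * q + b) u -> (s * u)`_a`_b = s`_0`_0 * u`_a`_b.
Proof.
move=> aq bq u0; rewrite coefM2 !big_ord_recl /= !subn0.
rewrite [X in _ + X + _]big1 ?addr0 => [|j _]; last first.
  rewrite [v in _ * v]u0 ?mulr0 //= /bump /=; first by rewrite /=; lia.
  by have := ltn_ord j; lia.
rewrite big1 ?addr0 // => i _; rewrite big1 // => j _.
rewrite [v in _ * v]u0 ?mulr0 //= /bump /=; have := ltn_ord i; try lia.
by nia.
Qed.

(** Elements with nonzero constant term are units modulo (x^q, y^q); this is what
    lets the filtration pass to the local ring. *)
Lemma vanishes_below_unit q T s u : s`_0`_0 != 0 ->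
  vanishes_below q T (s * u) -> vanishes_below q T u.
Proof.
move=> s0 su0 a b; have [m] := ubnP (a * q + b).
elim: m a b => // m IHm a b abm aq bq abT.
have := su0 a b aq bq abT; rewrite (@coefM_initial q) //.
  by move/eqP; rewrite mulf_eq0 (negPf s0) => /eqP.
move=> a' b' a'q b'q lt; apply: IHm => //; first exact: leq_trans lt _.
exact: ltn_trans lt abT.
Qed.

Lemma not_vanishes_below_initial q T u : ~ vanishes_below q T u ->
  exists a b, [/\ (a < q)%N, (b < q)%N, (a * q + b < T)%N & initial_at q u a b].
Proof.
elim: T => [|T IHT] uN0; first by case: uN0.
have [uT|/IHT[a [b [aq bq abT iab]]]] := pselect (vanishes_below q T u); last first.
  by exists a, b; split=> //; apply: leqW.
apply: contrapT => no_init; apply: uN0 => a b aq bq.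
rewrite ltnS leq_eqVlt => /orP[/eqP abT|]; last exact: uT.
apply/eqP; apply: contrapT => /negP uab; apply: no_init.
by exists a, b; split; rewrite ?abT //; split; rewrite ?abT.
Qed.

Lemma initialsP q g (ab : 'I_q * 'I_q) :
  reflect (exists s, initial_at q (s * g) ab.1 ab.2) (ab \in initials q g).
Proof. by rewrite inE; apply: asboolP. Qed.

(** The representative modulo (x^q, y^q) whose lexicographically lowest term is
    the one found inside the box of exponents below q. *)
Definition box_part q u : bipoly K :=
  \poly_(a < q) \poly_(b < q) u`_a`_b.

Lemma coef_box_part q u a b :
  (box_part q u)`_a`_b = if (a < q)%N && (b < q)%N then u`_a`_b else 0.
Proof.
rewrite /box_part coef_poly; case: ltnP => aq; last by rewrite coef0.
by rewrite coef_poly.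
Qed.

Lemma initial_at_eq q u v a b : (a < q)%N -> (b < q)%N ->
  (forall a b, (a < q)%N -> (b < q)%N -> u`_a`_b = v`_a`_b) ->
  initial_at q u a b -> initial_at q v a b.
Proof.
move=> aq bq uv [uab u0]; split=> [|a' b' a'q b'q lt]; first by rewrite -uv.
by rewrite -uv // u0.
Qed.

Lemma initials_mul_sub q g h : initials q (g * h) \subset initials q g.
Proof.
apply/fintype.subsetP => ab /initialsP[s init_s]; apply/initialsP.
by exists (s * h); rewrite -mulrA (mulrC h).
Qed.

(** The lexicographic order is multiplicative as long as the product of the two
    lowest monomials stays in the box. *)
Lemma initial_mul q u v a b a0 b0 : (a + a0 < q)%N -> (b + b0 < q)%N ->
  (forall a' b', u`_a'`_b' != 0 -> ((a < a') || (a == a') && (b <= b'))%N) ->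
  u`_a`_b != 0 ->
  (forall a' b', v`_a'`_b' != 0 -> ((a0 < a') || (a0 == a') && (b0 <= b'))%N) ->
  v`_a0`_b0 != 0 ->
  initial_at q (u * v) (a + a0) (b + b0).
Proof.
move=> aq bq u_min uab v_min vab.
have term0 a' b' i j : (i <= a')%N -> (j <= b')%N ->
    u`_i`_j * v`_(a' - i)`_(b' - j) != 0 ->
    ((a + a0 < a') || (a + a0 == a') && (b + b0 <= b'))%N /\
    ((a + a0 == a') && (b + b0 == b') -> (i == a) && (j == b))%N.
  move=> ia jb; rewrite mulf_eq0 negb_or => /andP[/u_min uij /v_min vij].
  by split; lia.
split.
  rewrite coefM2 (bigD1 (inord a)) //= (bigD1 (inord b)) //=.
  rewrite !inordK ?ltnS ?leq_addr //.
  rewrite [X in _ + X]big1 ?addr0 => [|i i_neq].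
    rewrite big1 ?addr0 => [|j j_neq]; first by rewrite !addKn mulf_neq0.
    apply/eqP; apply: contraNT j_neq => /term0[||_].
    - by rewrite leq_addr.
    - by rewrite -ltnS ltn_ord.
    rewrite !eqxx => /(_ isT) /eqP jb.
    by apply/eqP/val_inj; rewrite /= inordK ?ltnS ?leq_addr.
  rewrite big1 // => j _; apply/eqP; apply: contraNT i_neq => /term0[||_].
  - by rewrite -ltnS ltn_ord.
  - by rewrite -ltnS ltn_ord.
  rewrite !eqxx => /(_ isT) /andP[/eqP ia _].
  by apply/eqP/val_inj; rewrite /= inordK ?ltnS ?leq_addr.
move=> a' b' a'q b'q lt; rewrite coefM2 big1 // => i _; rewrite big1 // => j _.
apply/eqP; apply: contraTT lt => /term0[||H _].
- by rewrite -ltnS ltn_ord.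
- by rewrite -ltnS ltn_ord.
rewrite -leqNgt; case/orP: H => H; nia.
Qed.

(** Shifting by the lowest monomial of h sends initial monomials for g to
    initial monomials for g h, except for those pushed out of the box, which lie
    in a0 columns and b0 rows. *)
Lemma card_initials_mul q g (h : bipoly K) a0 b0 :
  (forall a b, h`_a`_b != 0 -> ((a0 < a) || (a0 == a) && (b0 <= b))%N) ->
  h`_a0`_b0 != 0 ->
  (#|initials q g| <= #|initials q (g * h)| + q * (a0 + b0))%N.
Proof.
move=> h_min hab.
have [q0|q_gt0] := posnP q.
  suff -> : initials q g = finset.set0 by rewrite cards0.
  by apply/setP=> -[a b]; case: (notF (etrans (esym (ltn0 a)) _)); rewrite -[0%N]q0 ltn_ord.
pose out := [set ab : 'I_q * 'I_q | (q - a0 <= ab.1)%N || (q - b0 <= ab.2)%N].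
pose shift (ab : 'I_q * 'I_q) : 'I_q * 'I_q :=
  (insubd ab.1 (ab.1 + a0)%N, insubd ab.2 (ab.2 + b0)%N).
have out_card : (#|out| <= q * (a0 + b0))%N.
  apply: (@leq_trans (#|finset.setX [set i : 'I_q | (q - a0 <= i)%N] finset.setT|
                  + #|finset.setX finset.setT [set i : 'I_q | (q - b0 <= i)%N]|)).
    rewrite -[leqLHS]addn0 -(cards0 ('I_q * 'I_q)%type).
    apply: leq_trans (leq_card_setU _ _); rewrite cards0 addn0 subset_leq_card //.
    by apply/fintype.subsetP=> ab; rewrite !inE andbT.
  rewrite !cardsX !cardsT !card_ord mulnDr leq_add //.
    by rewrite mulnC leq_mul ?card_ord_geq.
  by rewrite leq_mul ?card_ord_geq.
rewrite -(cardsID out (initials q g)) addnC leq_add //; last first.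
  by apply: leq_trans out_card; rewrite subset_leq_card // subsetIr.
have inj_shift : {in initials q g :\: out &, injective shift}.
  move=> [a b] [a' b'] /setDP[_]; rewrite inE negb_or /= -!ltnNge => /andP[aq bq].
  move=> /setDP[_]; rewrite inE negb_or /= -!ltnNge => /andP[a'q b'q].
  case=> /(congr1 val) + /(congr1 val); rewrite !val_insubd.
  rewrite !ifT; [|lia..] => /addIn aa' /addIn bb'.
  by congr (_, _); apply: val_inj.
rewrite -(card_in_imset inj_shift) subset_leq_card //.
apply/fintype.subsetP => _ /imsetP[[a b] /setDP[/initialsP[s [sab s0]]] + ->].
rewrite inE negb_or /= -!ltnNge => /andP[aq bq]; apply/initialsP.
pose u := box_part q (s * g).
exists s; rewrite mulrA /= !val_insubd !ifT; [|lia..].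
have u_min a' b' : u`_a'`_b' != 0 -> ((a < a') || (a == a' :> nat) && (b <= b'))%N.
  rewrite coef_box_part; case: ifP => [/andP[a'q b'q]|]; last by rewrite eqxx.
  apply: contraR => nlt; rewrite s0 //=; move: nlt; have := ltn_ord b; nia.
apply: (@initial_at_eq q (u * h)); [lia|lia| |].
  move=> a' b' a'q b'q; rewrite !coefM2; apply: eq_bigr => i _.
  apply: eq_bigr => j _; rewrite coef_box_part ifT //.
  by have := ltn_ord i; have := ltn_ord j; lia.
by apply: initial_mul => //; rewrite ?coef_box_part ?ltn_ord //; lia.
Qed.

Lemma card_initials_le q g : (#|initials q g| <= q * q)%N.
Proof. by rewrite (leq_trans (max_card _)) // card_prod card_ord. Qed.

End Initials.

(** * Frobenius and the scaling of initial monomials *)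
Section Cartier.

(** An additive map phi with phi (u v^p) = phi u * v is a linear map from the
    Frobenius pushforward; decimation extends it to polynomials, and doing this
    twice to the p-th root of k gives the operators on k[x,y] dual to Frobenius. *)
Section Decimation.
Variables (A : comNzRingType) (p : nat) (phi : A -> A).
Hypothesis pA : p \in [pchar A].
Hypothesis phiD : {morph phi : u v / u + v}.
Hypothesis phiM : forall u v, phi (u * v ^+ p) = phi u * v.

Let p_gt0 : (0 < p)%N. Proof. by rewrite prime_gt0 // (pcharf_prime pA). Qed.

Lemma phi_at0 : phi 0 = 0.
Proof. by apply: (addrI (phi 0)); rewrite -phiD !addr0. Qed.

Definition decimate i (u : {poly A}) : {poly A} :=
  \poly_(a < size u) phi u`_(p * a + i).

Lemma coef_decimate i u a : (decimate i u)`_a = phi u`_(p * a + i).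
Proof.
rewrite coef_poly; case: ltnP => // /leq_trans le; rewrite nth_default ?phi_at0 //.
by apply: le; nia.
Qed.

Lemma decimateD i : {morph decimate i : u v / u + v}.
Proof. by move=> u v; apply/polyP=> a; rewrite coefD !coef_decimate coefD phiD. Qed.

Lemma decimateM i u v : (i < p)%N -> decimate i (u * v ^+ p) = decimate i u * v.
Proof.
have pP : p \in [pchar {poly A}] by rewrite pchar_poly.
move=> ip; elim/poly_ind: v => [|v c IHv].
  rewrite expr0n eqn0Ngt p_gt0 !mulr0; apply/polyP => a.
  by rewrite coef_decimate !coef0 phi_at0.
rewrite -[(_ + _) ^+ p](pFrobenius_autE pP) rmorphD /= !pFrobenius_autE.
rewrite exprMn !mulrDr mulrA decimateD !mulrA -{}IHv -polyC_exp.
congr (_ + _); apply/polyP => a.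
  rewrite coef_decimate coefMXn coefMX coef_decimate.
  case: a => [|a]; first by rewrite muln0 add0n ip phi_at0.
  by rewrite ifF; [congr (phi _`_ _); nia|nia].
by rewrite coefMC !coef_decimate coefMC phiM.
Qed.

End Decimation.

Lemma coefXp (A : comNzRingType) (p : nat) (v : {poly A}) a : p \in [pchar A] ->
  (v ^+ p)`_a = if (p %| a)%N then v`_(a %/ p) ^+ p else 0.
Proof.
move=> pA; have p_gt0 : (0 < p)%N by rewrite prime_gt0 // (pcharf_prime pA).
have pP : p \in [pchar {poly A}] by rewrite pchar_poly.
elim/poly_ind: v a => [|v c IHv] a.
  by rewrite expr0n eqn0Ngt p_gt0 !coef0 expr0n eqn0Ngt p_gt0 if_same.
rewrite -[(_ + _) ^+ p](pFrobenius_autE pP) rmorphD /= !pFrobenius_autE.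
rewrite exprMn -polyC_exp coefD coefMXn coefC IHv coefD coefMX coefC.
case: ltnP => [ap|pa].
  case: a ap => [|a] ap; first by rewrite dvdn0 div0n /= !add0r.
  by rewrite gtnNdvd //= addr0.
rewrite dvdn_subl ?dvdnn //; case: ifP => pda; last first.
  by rewrite gtn_eqF ?addr0 //; exact: leq_trans pa.
have a_gt0 : (0 < a)%N by exact: leq_trans pa.
rewrite !gtn_eqF ?divn_gt0 // !addr0; congr (_`_ _ ^+ _).
by rewrite -{2}(subnK pa) divnDr // divnn p_gt0 addn1.
Qed.

Section FrobeniusScaling.
Variables (k : fieldType) (p : nat).
Hypothesis pk : p \in [pchar k].
Hypothesis k_perfect : forall a : k, exists b, b ^+ p = a.

Definition proot (a : k) : k := sval (cid (k_perfect a)).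

Lemma prootK a : proot a ^+ p = a.
Proof. exact: svalP (cid (k_perfect a)). Qed.

Lemma proot_inj : injective (fun x : k => x ^+ p).
Proof. by move=> x y /= xy; apply: (fmorph_inj (pFrobenius_aut pk)). Qed.

Lemma prootD : {morph proot : a b / a + b}.
Proof.
move=> a b; apply: proot_inj; rewrite prootK.
by rewrite -(pFrobenius_autE pk) rmorphD /= !pFrobenius_autE !prootK.
Qed.

Lemma prootM a b : proot (a * b ^+ p) = proot a * b.
Proof. by apply: proot_inj; rewrite prootK exprMn prootK. Qed.

(** The coefficient of x^i y^j in the basis of S over S^p, followed by p-th
    roots. *)
Definition cartier i j : bipoly k -> bipoly k :=
  decimate p (decimate p proot j) i.

Lemma pchar_polyk : p \in [pchar {poly k}]. Proof. by rewrite pchar_poly. Qed.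

Lemma cartierD i j : {morph cartier i j : u v / u + v}.
Proof. move=> u v; exact: (@decimateD _ p _ pchar_polyk (decimateD pk prootD j)). Qed.

Lemma cartierM i j u v : (i < p)%N -> (j < p)%N ->
  cartier i j (u * v ^+ p) = cartier i j u * v.
Proof.
move=> ip jp; apply: decimateM ip; first exact: pchar_polyk.
  exact: (decimateD pk prootD j).
move=> {}u {}v; apply: decimateM jp => //; [exact: prootD|exact: prootM].
Qed.

Lemma coef_cartier i j u a b :
  (cartier i j u)`_a`_b = proot u`_(p * a + i)`_(p * b + j).
Proof.
have D := decimateD pk prootD j.
by rewrite (coef_decimate pchar_polyk D) (coef_decimate pk prootD).
Qed.

Lemma coefXp2 (u : bipoly k) a b : (u ^+ p)`_a`_b =
  if (p %| a)%N && (p %| b)%N then u`_(a %/ p)`_(b %/ p) ^+ p else 0.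
Proof.
rewrite coefXp ?pchar_polyk //; case: (p %| a)%N; last by rewrite coef0.
by rewrite coefXp.
Qed.

(** S is free over S^p on the monomials x^i y^j with i, j < p, and their
    multiples have distinct initial terms.  So the initial monomials for g^p are
    the (p c + i, p d + j) with (c, d) initial for g: one direction extracts a
    component with [cartier], the other multiplies a p-th power by x^i y^j. *)
Lemma mem_initials_Frobenius q (g : bipoly k) (ab : 'I_(p * q) * 'I_(p * q))
    (cd : 'I_q * 'I_q) :
  (ab.1 %/ p)%N = cd.1 -> (ab.2 %/ p)%N = cd.2 ->
  (ab \in initials (p * q) (g ^+ p)) = (cd \in initials q g).
Proof.
have p_gt0 : (0 < p)%N by rewrite prime_gt0 // (pcharf_prime pk).
case: ab cd => [a b] [c d] /= ac bd.
have aE := divn_eq a p; have bE := divn_eq b p; rewrite ac in aE; rewrite bd in bE.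
have ltap := ltn_pmod a p_gt0; have ltbp := ltn_pmod b p_gt0.
set i := (a %% p)%N in aE ltap *; set j := (b %% p)%N in bE ltbp *.
have cq := ltn_ord c; have dq := ltn_ord d.
apply/initialsP/initialsP => -[s /= [sab s0]].
  exists (cartier i j s); split => [|a' b' a'q b'q lt] /=.
    rewrite -cartierM // coef_cartier -(inj_eq proot_inj) prootK expr0n.
    by rewrite eqn0Ngt p_gt0 [(p * c)%N]mulnC -aE [(p * d)%N]mulnC -bE.
  rewrite -cartierM // coef_cartier s0; [|nia|nia|].
    by apply: proot_inj; rewrite prootK expr0n eqn0Ngt p_gt0.
  move: lt; rewrite !ltn_index //; [|nia].
  by case/orP => [|/andP[/eqP]]; nia.
exists ('X^i * ('X^j)%:P * s ^+ p).
have E a' b' : ('X^i * ('X^j)%:P * s ^+ p * g ^+ p)`_a'`_b' =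
    if (i <= a')%N && (j <= b')%N then ((s * g) ^+ p)`_(a' - i)`_(b' - j) else 0.
  rewrite -!mulrA -exprMn coefXnM ltnNge; case: (i <= a')%N; last by rewrite coef0.
  by rewrite coefCM coefXnM ltnNge; case: (j <= b')%N.
split => [|a' b' a'q b'q lt] /=.
  rewrite E {1}aE {1}bE !leq_addl /= coefXp2.
  have -> : (a - i)%N = (c * p)%N by lia.
  have -> : (b - j)%N = (d * p)%N by lia.
  by rewrite !dvdn_mull // !mulnK // expf_eq0 p_gt0.
rewrite E; case: ifP => // /andP[ia jb]; rewrite coefXp2.
case: ifP => // /andP[/dvdnP[a1 a1E] /dvdnP[b1 b1E]].
rewrite a1E b1E !mulnK // s0 ?expr0n ?eqn0Ngt ?p_gt0 //; [nia|nia|].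
have {a1E} a'E : a' = (a1 * p + i)%N by rewrite -a1E subnK.
have {b1E} b'E : b' = (b1 * p + j)%N by rewrite -b1E subnK.
move: lt; rewrite !ltn_index //; [|nia].
by case/orP => [|/andP[/eqP]]; nia.
Qed.

Lemma digit_ltn q (i : 'I_p) (c : 'I_q) : (c * p + i < p * q)%N.
Proof. by have := ltn_ord i; have := ltn_ord c; nia. Qed.

Lemma card_initials_Frobenius q (g : bipoly k) :
  #|initials (p * q) (g ^+ p)| = (p ^ 2 * #|initials q g|)%N.
Proof.
have p_gt0 : (0 < p)%N by rewrite prime_gt0 // (pcharf_prime pk).
pose digit i (c : 'I_q) := Ordinal (digit_ltn i c).
pose F (x : ('I_p * 'I_p) * ('I_q * 'I_q)) :=
  (digit x.1.1 x.2.1, digit x.1.2 x.2.2).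
have digit_div i c : (digit i c %/ p)%N = c :> nat.
  by rewrite /= divnMDl // divn_small ?addn0.
have digit_mod i c : (digit i c %% p)%N = i :> nat.
  by rewrite /= modnMDl modn_small.
have F_inj : injective F.
  move=> [[i j] [c d]] [[i' j'] [c' d']] [e1 e2].
  have val_digit (i1 i2 : 'I_p) (c1 c2 : 'I_q) :
      (c1 * p + i1 = c2 * p + i2)%N -> digit i1 c1 = digit i2 c2.
    by move=> e; apply: val_inj.
  move/val_digit in e1; move/val_digit in e2; congr (_, _); congr (_, _); apply: val_inj => /=.
  - by rewrite -(digit_mod i c) e1 digit_mod.
  - by rewrite -(digit_mod j d) e2 digit_mod.
  - by rewrite -(digit_div i c) e1 digit_div.
  - by rewrite -(digit_div j d) e2 digit_div.
transitivity #|finset.setX [set: 'I_p * 'I_p] (initials q g)|; last first.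
  by rewrite cardsX cardsT card_prod card_ord mulnn.
rewrite -(card_imset _ F_inj).
congr #|pred_of_set _|; apply/setP => -[a b]; apply/idP/imsetP.
  have ltq (x : 'I_(p * q)) : (x %/ p < q)%N by rewrite ltn_divLR // [(q * p)%N]mulnC.
  have ltp (x : 'I_(p * q)) : (x %% p < p)%N by rewrite ltn_pmod.
  move=> ab; exists ((Ordinal (ltp a), Ordinal (ltp b)), (Ordinal (ltq a), Ordinal (ltq b))).
    by rewrite finset.in_setX finset.in_setT -(@mem_initials_Frobenius q g (a, b)).
  by congr (_, _); apply: val_inj; rewrite /= -divn_eq.
case=> -[[i j] [c d]]; rewrite finset.in_setX finset.in_setT /= => cd [-> ->].
by rewrite (@mem_initials_Frobenius q g _ (c, d)) ?digit_div.
Qed.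

End FrobeniusScaling.
End Cartier.

(** * The Wronskian argument *)
Section Wronskian.
Variables (k : fieldType) (p : nat).
Hypothesis pk : p \in [pchar k].
Implicit Types (s u A B F : {poly k}).

Lemma deriv_eq0_size u : (size u <= p)%N -> u^`() = 0 -> (size u <= 1)%N.
Proof.
move=> up du; apply/leq_sizeP => i i_gt0; case: (ltnP i p) => [ip|pi]; last first.
  by rewrite nth_default // (leq_trans up).
have := congr1 (fun v : {poly k} => v`_i.-1) du; rewrite coef_deriv coef0 prednK //.
move/eqP; rewrite -mulr_natr mulf_eq0 => /orP[/eqP //|].
by rewrite -(dvdn_pcharf pk) gtnNdvd.
Qed.

Lemma size_wronskian A B : A^`() * B - A * B^`() != 0 ->
  (size (A^`() * B - A * B^`())%R < (size A + size B).-1)%N.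
Proof.
have [->|A0] := eqVneq A 0; first by rewrite deriv0 !mul0r subrr eqxx.
have [->|B0] := eqVneq B 0; first by rewrite deriv0 !mulr0 subrr eqxx.
move=> _; apply: leq_ltn_trans (size_polyD _ _) _; rewrite size_polyN.
have lA := lt_size_deriv A0; have lB := lt_size_deriv B0.
have sA : (0 < size A)%N by rewrite size_poly_gt0.
have sB : (0 < size B)%N by rewrite size_poly_gt0.
rewrite gtn_max; apply/andP; split; apply: leq_ltn_trans (size_polyMleq _ _) _.
  by rewrite ltn_predRL prednK ?addn_gt0 ?sB ?orbT // ltn_add2r.
by rewrite ltn_predRL prednK ?addn_gt0 ?sA // ltn_add2l.
Qed.

(** After division by the gcd, a' b = a b' with a, b coprime forces a to divide
    a', hence a' = 0; below degree p this means that a is constant, and then so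
    is b. *)
Lemma wronskian_eq0 A B : A != 0 -> (size A <= p)%N -> (size B <= p)%N ->
  A^`() * B = A * B^`() -> exists g c e, [/\ c != 0, A = c *: g & B = e *: g].
Proof.
move=> A0 Ap Bp W.
have g0 : gcdp A B != 0 by rewrite gcdp_eq0 (negPf A0).
have [a Aa] := dvdpP _ _ (dvdp_gcdl A B); have [b Bb] := dvdpP _ _ (dvdp_gcdr A B).
move: g0 Aa Bb; set g := gcdp A B => g0 Aa Bb.
have a0 : a != 0 by apply: contraNneq A0; rewrite Aa => ->; rewrite mul0r.
have ab : coprimep a b.
  have := @coprimep_div_gcd _ A B; rewrite A0 /= => /(_ isT).
  by rewrite -/g {1}Aa Bb !mulpK.
have small u v : u = v * g -> (size u <= p)%N -> (size v <= p)%N.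
  move=> -> ; have [->|v0] := eqVneq v 0; first by rewrite size_poly0.
  apply: leq_trans; rewrite size_mul //; move: g0; rewrite -size_poly_gt0; lia.
have w : a^`() * b = a * b^`().
  have gg : g * g != 0 by rewrite mulf_neq0.
  apply: (mulfI gg); apply/eqP; rewrite -subr_eq0; apply/eqP.
  move/eqP: W; rewrite Aa Bb !derivM -subr_eq0 => /eqP <-.
  by clearbody g; ring.
have da : a^`() = 0.
  apply/eqP; apply: contraTT (dvdp_mulr b^`() (dvdpp a)) => da.
  rewrite -w Gauss_dvdpl //; apply: contraTN (lt_size_deriv a0) => /dvdp_leq.
  by rewrite -leqNgt; apply.
have a1 := deriv_eq0_size (small _ _ Aa Ap) da.
have db : b^`() = 0.
  by apply/eqP; move/eqP: w; rewrite da mul0r eq_sym mulf_eq0 (negPf a0).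
have b1 := deriv_eq0_size (small _ _ Bb Bp) db.
exists g, a`_0, b`_0; rewrite -!mul_polyC -!size1_polyC //; split=> //.
by apply: contraNneq a0 => a00; rewrite [a]size1_polyC // a00.
Qed.

Hypothesis k_perfect : forall a : k, exists b, b ^+ p = a.

Lemma mup_leq_size x u : u != 0 -> (mup x u < size u)%N.
Proof.
move=> u0; have := mup_geq x (mup x u) u0; rewrite leqnn => /esym/dvdp_leq.
by rewrite size_exp_XsubC; apply.
Qed.

Lemma mupX x u n : u != 0 -> mup x (u ^+ n) = (n * mup x u)%N.
Proof.
move=> u0; elim: n => [|n IHn].
  by rewrite expr0 mupNroot // root1.
by rewrite exprS mupM ?expf_neq0 // IHn mulSn.
Qed.

(** Dehomogenized at y = 1: the form s f^n of degree j + r n is not in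
    (x^p, y^p).  The polynomial F may have degree r - 1 instead of r, when y is
    one of the linear factors. *)
Lemma band_neq0 r F n j s : (2 <= r)%N -> (r <= size F <= r.+1)%N ->
  (forall x, (mup x F <= 1)%N) ->
  (2 * j + r * n + r <= 2 * p)%N -> s != 0 -> (size s <= j.+1)%N ->
  exists a, [/\ (j + r * n < p + a)%N, (a < p)%N & (s * F ^+ n)`_a != 0].
Proof.
move=> r2 /andP[rF Fr] F_sqfree bound s0 sj.
have F0 : F != 0 by rewrite -size_poly_gt0; lia.
have [rho rhoE] : exists rho, size F = rho.+1 by exists (size F).-1; lia.
have p_gt0 : (0 < p)%N by rewrite prime_gt0 // (pcharf_prime pk).
pose G := s * F ^+ n.
have G0 : G != 0 by rewrite mulf_neq0 ?expf_neq0.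
have sizeG : size G = (size s + n * rho)%N.
  rewrite size_mul ?expf_neq0 // -[size (F ^+ n)]prednK ?size_poly_gt0 ?expf_neq0 //.
  by rewrite size_exp rhoE /= addnS mulnC.
apply: contrapT => no_band.
have G_band a : (j + r * n < p + a)%N -> (a < p)%N -> G`_a = 0.
  by move=> aj ap; apply/eqP; apply: contrapT => /negP Ga; apply: no_band; exists a.
have [dp|pd] := ltnP (j + r * n) p.
  have : G`_(size G).-1 != 0 by rewrite -lead_coefE lead_coef_eq0.
  rewrite G_band ?eqxx //; [nia|nia].
have n_gt0 : (0 < n)%N by nia.
have jn : (j + n < p)%N by nia.
set A := drop_poly p G; set B := take_poly p G.
(* With no coefficient in the window, A and B are forms of degree
   j + r n - p < p in disguise. *)
have GE : G = A * 'X^p + B by rewrite addrC poly_take_drop.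
have sizeA : (size A <= j.+1 + n * rho - p)%N.
  by rewrite size_drop_poly sizeG; lia.
have sizeB : (size B <= (j + r * n - p).+1)%N.
  apply/leq_sizeP => a ma; rewrite coef_take_poly; case: ifP => // ap.
  by rewrite G_band //; lia.
have dXp : ('X^p : {poly k})^`() = 0.
  by rewrite derivXn -mulr_natr -polyC_natr pcharf0 // polyC0 mulr0.
(* 'X^p is a constant for the derivation, so the Wronskian of A and B is that
   of A and G, and F^(n-1) divides both G and its derivative. *)
have W_G : A^`() * B - A * B^`() = A^`() * G - A * G^`().
  rewrite GE derivD derivM dXp; ring.
have [W0|W_neq0] := eqVneq (A^`() * B - A * B^`()) 0; last first.
  have dvdW : F ^+ n.-1 %| A^`() * B - A * B^`().
    have dvdG : F ^+ n.-1 %| G.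
      by rewrite dvdp_mull // -{2}(prednK n_gt0) exprS dvdp_mull.
    have dvd'G : F ^+ n.-1 %| G^`().
      rewrite derivM dvdp_add //; first by rewrite dvdp_mull // -{2}(prednK n_gt0) exprS dvdp_mull.
      by rewrite deriv_exp -mulrnAl mulrA dvdp_mull.
    by rewrite W_G dvdp_sub // dvdp_mull.
  have := dvdp_leq W_neq0 dvdW.
  rewrite -[size (F ^+ _)]prednK ?size_poly_gt0 ?expf_neq0 // size_exp rhoE /=.
  have no_room sA sB sW : (sA <= j.+1 + n * rho - p)%N ->
      (sB <= (j + r * n - p).+1)%N -> (sW < (sA + sB).-1)%N ->
      (rho * n.-1 < sW)%N -> False.
    by case: (n) n_gt0 bound pd => // n' _; nia.
  exact: no_room sizeA sizeB (size_wronskian W_neq0).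
(* This is the case where y^p divides the form s f^n. *)
have [A0|A_neq0] := eqVneq A 0.
  move: sizeB; rewrite -[B]add0r -(mul0r 'X^p) -A0 -GE sizeG.
  have : (0 < size s)%N by rewrite size_poly_gt0.
  nia.
have mp : (j + r * n - p < p)%N by nia.
have [g [c [e [c0 Ag Bg]]]] : exists g c e, [/\ c != 0, A = c *: g & B = e *: g].
  apply: wronskian_eq0 => //; [nia|nia|].
  by apply/eqP; rewrite -subr_eq0 W0.
(* c X^p + e is the p-th power of a linear polynomial with root - e' / c'. *)
have [c' c'E] := k_perfect c; have [e' e'E] := k_perfect e.
have c'0 : c' != 0 by apply: contraNneq c0 => c'0; rewrite -c'E c'0 expr0n gtn_eqF.
have GE' : G = (c *: g) * ('X - (- e' / c')%:P) ^+ p.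
  have pP : p \in [pchar {poly k}] by rewrite pchar_poly.
  rewrite GE Ag Bg -[(_ - _) ^+ p](pFrobenius_autE pP) rmorphB /= !pFrobenius_autE.
  rewrite -polyC_exp mulrBr; congr (_ + _).
  have -> : (- e' / c') ^+ p = - (e / c).
    rewrite mulNr -(pFrobenius_autE pk) rmorphN /= pFrobenius_autE.
    by rewrite expr_div_n c'E e'E.
  by rewrite polyCN mulrN opprK mulrC mul_polyC scalerA divfK.
have : (p <= mup (- e' / c') G)%N.
  by rewrite mup_geq // GE' dvdp_mulIr.
rewrite mupM ?expf_neq0 // mupX //.
have := mup_leq_size (- e' / c') s0; have := F_sqfree (- e' / c').
nia.
Qed.
End Wronskian.

(** * Leading positions of a row space *)
Section Leads.
Variables (k : fieldType) (m n : nat) (T : 'M[k]_(m, n)).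

Definition lead_set : {set 'I_n} := [set j : 'I_n | `[< exists u : 'rV_m,
  (u *m T) 0 j != 0 /\ forall j' : 'I_n, (j' < j)%N -> (u *m T) 0 j' = 0 >]].

Lemma lead_setP (j : 'I_n) : reflect (exists u : 'rV_m,
  (u *m T) 0 j != 0 /\ forall j' : 'I_n, (j' < j)%N -> (u *m T) 0 j' = 0)
  (j \in lead_set).
Proof. by rewrite inE; apply: asboolP. Qed.

Lemma lead_exists (u : 'rV_m) : u *m T != 0 ->
  exists j, [/\ j \in lead_set & (u *m T) 0 j != 0].
Proof.
move=> /rV0Pn[j0 uj0].
case: (arg_minnP (fun j : 'I_n => nat_of_ord j) (P := fun j => (u *m T) 0 j != 0) uj0).
move=> j uj jmin; exists j; split=> //; apply/lead_setP; exists u; split=> // j' j'j.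
by apply/eqP; apply: contraTT j'j => /jmin; rewrite -leqNgt.
Qed.

(** A vector of the row space that vanishes at all leading positions is zero, so
    restricting to these columns keeps the rank. *)
Lemma card_lead_set_ge : (\rank T <= #|lead_set|)%N.
Proof.
pose S : 'M[k]_(n, #|lead_set|) := \matrix_(j, i) (j == enum_val i)%:R.
have TS (u : 'rV_m) i : (u *m T *m S) 0 i = (u *m T) 0 (enum_val i).
  rewrite mxE (bigD1 (enum_val i)) //= [S _ _]mxE eqxx mulr1 big1 ?addr0 // => j.
  by rewrite [S _ _]mxE => /negPf ->; rewrite mulr0.
suff kerE : (kermx (T *m S) <= kermx T)%MS.
  apply: leq_trans (rank_leq_col (T *m S)).
  have := mxrankS kerE; rewrite !mxrank_ker.
  have := rank_leq_row T; have := rank_leq_row (T *m S); lia.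
apply/row_subP => i; apply/sub_kermxP; set u := row i _.
apply/eqP; apply/negPn/negP => /lead_exists[j [jL]].
have /rowP/(_ (enum_rank_in jL j)) : u *m T *m S = 0.
  by rewrite -mulmxA; apply/sub_kermxP; exact: row_sub.
by rewrite TS enum_rankK_in // => ->; rewrite mxE eqxx.
Qed.

(** Vectors with distinct leading positions are independent, and so are the
    coefficient vectors that produce them. *)
Lemma card_lead_set_le : (#|lead_set| <= m)%N.
Proof.
have /choice[w wP] (i : 'I_#|lead_set|) : exists u : 'rV_m,
    (u *m T) 0 (enum_val i) != 0 /\
    forall j' : 'I_n, (j' < enum_val i)%N -> (u *m T) 0 j' = 0.
  by apply/lead_setP; exact: enum_valP.
pose W := \matrix_i w i.
suff : row_free W by move=> /eqP <-; exact: rank_leq_col.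
have WT i j : (W *m T) i j = (w i *m T) 0 j.
  by rewrite -[w i](rowK w) -row_mul [RHS]mxE.
apply/inj_row_free => v vW; apply/eqP; apply/negPn/negP => /rV0Pn[i0 vi0].
case: (arg_minnP (fun i => nat_of_ord (enum_val i)) (P := fun i => v 0 i != 0) vi0).
move=> i vi imin; have : (v *m W *m T) 0 (enum_val i) = 0 by rewrite vW mul0mx mxE.
rewrite -mulmxA mxE (bigD1 i) //= big1 ?addr0 => [|i' i'i].
  by move/eqP; rewrite mulf_eq0 (negPf vi) /= WT; have [/negPf->] := wP i.
have [->|vi'] := eqVneq (v 0 i') 0; first by rewrite mul0r.
rewrite WT (proj2 (wP i')) ?mulr0 // ltn_neqAle imin // andbT.
by apply: contraNneq i'i => /val_inj/enum_val_inj ->.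
Qed.
End Leads.

(** * Counting initial monomials of multiples of a form *)
Section Graded.
Variable k : fieldType.
Implicit Types (G s : {poly k}) (u : bipoly k).

Definition homogenize d G : bipoly k := \poly_(a < d.+1) (G`_a *: 'X^(d - a)).

Definition graded_part d u : {poly k} := \poly_(a < d.+1) u`_a`_(d - a).

Lemma coef_graded_part d u a :
  (graded_part d u)`_a = if (a < d.+1)%N then u`_a`_(d - a) else 0.
Proof. by rewrite coef_poly. Qed.

Lemma coef_homogenize d G a b : (size G <= d.+1)%N ->
  (homogenize d G)`_a`_b = if (a + b == d)%N then G`_a else 0.
Proof.
move=> Gd; rewrite coef_poly; case: ltnP => ad; last first.
  by rewrite coef0 nth_default ?if_same // (leq_trans Gd).
rewrite coefZ coefXn -[(b == _)]/(b == _ :> nat).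
have -> : (b == d - a)%N = (a + b == d)%N by lia.
by case: eqP; rewrite ?mulr1 ?mulr0.
Qed.

Lemma homogenizeK d G : (size G <= d.+1)%N -> graded_part d (homogenize d G) = G.
Proof.
move=> Gd; apply/polyP => a; rewrite coef_graded_part; case: ltnP => ad; last first.
  by rewrite nth_default // (leq_trans Gd).
by rewrite coef_homogenize // subnKC // eqxx.
Qed.

(** Multiples of a form can be studied one degree at a time, in one variable. *)
Lemma coefM_homogenize u e G a b : (size G <= e.+1)%N ->
  (u * homogenize e G)`_a`_b =
  if (e <= a + b)%N then (graded_part (a + b - e) u * G)`_a else 0.
Proof.
move=> Ge; rewrite coefM2; case: leqP => eab; last first.
  rewrite big1 // => i _; rewrite big1 // => j _; rewrite coef_homogenize //.
  by have := ltn_ord i; have := ltn_ord j; case: eqP => [|_]; [lia|rewrite mulr0].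
rewrite coefM; apply: eq_bigr => i _; rewrite coef_graded_part ltnS.
have ia := ltn_ord i.
case: (ltnP e (a - i)) => aie.
  rewrite [G`_(a - i)]nth_default ?mulr0; last exact: leq_trans Ge _.
  rewrite big1 // => j _; rewrite coef_homogenize //; case: eqP => [|_]; last by rewrite mulr0.
  by lia.
case: leqP => ile; last first.
  rewrite mul0r big1 // => j _; rewrite coef_homogenize //; case: eqP => [|_]; last by rewrite mulr0.
  by have := ltn_ord j; lia.
have jb : (a + b - e - i < b.+1)%N by lia.
rewrite (bigD1 (Ordinal jb)) //= coef_homogenize // ifT; last lia.
rewrite big1 ?addr0 // => j jne; rewrite coef_homogenize // ifF ?mulr0 //.
apply/negbTE; apply: contra jne => /eqP jE; apply/eqP/val_inj => /=.
by have := ltn_ord j; lia.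
Qed.

Lemma size_mul_le d e G (H : {poly k}) : (size G <= d.+1)%N -> (size H <= e.+1)%N ->
  (size (G * H)%R <= (d + e).+1)%N.
Proof. by move=> Gd He; apply: leq_trans (size_polyMleq _ _) _; lia. Qed.

Lemma homogenizeM d e G (H : {poly k}) : (size G <= d.+1)%N -> (size H <= e.+1)%N ->
  homogenize d G * homogenize e H = homogenize (d + e) (G * H).
Proof.
move=> Gd He; have GH : (size (G * H)%R <= (d + e).+1)%N.
  exact: size_mul_le.
apply/polyP => a; apply/polyP => b; rewrite coefM_homogenize // coef_homogenize //.
case: (eqVneq (a + b)%N (d + e)%N) => [->|ne].
  by rewrite leq_addl addnK homogenizeK.
case: leqP => // eab; suff -> : graded_part (a + b - e) (homogenize d G) = 0.
  by rewrite mul0r coef0.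
apply/polyP => i; rewrite coef_graded_part coef0; case: ltnP => // ile.
by rewrite coef_homogenize // ifF //; lia.
Qed.

Lemma homogenizeX d G n : (size G <= d.+1)%N ->
  homogenize d G ^+ n = homogenize (d * n) (G ^+ n).
Proof.
move=> Gd; elim: n => [|n IHn].
  rewrite !expr0 muln0; apply/polyP => a; apply/polyP => b.
  rewrite coef_homogenize ?size_poly1 // !coef1.
  case: a => [|a] /=; last by rewrite coef0.
  by rewrite coef1; case: b.
rewrite exprS IHn homogenizeM ?mulnS ?exprS //.
apply: leq_trans (size_poly_exp_leq _ _) _; rewrite ltnS leq_mul2r; lia.
Qed.

Variables (q e : nat) (G : {poly k}).
Hypothesis Ge : (size G <= e.+1)%N.

Let init_hom := initials q (homogenize e G).
(** For bivariate forms the monomials of fixed degree are ordered by their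
    exponent in x, so each degree is a matter of leading positions of a matrix. *)
Definition init_deg d : {set 'I_q * 'I_q} := [set ab in init_hom | (ab.1 + ab.2 == d)%N].

Lemma mem_init_hom (ab : 'I_q * 'I_q) d : (ab.1 + ab.2 = d)%N ->
  reflect ((e <= d)%N /\ exists s, [/\ (size s <= (d - e).+1)%N, (s * G)`_ab.1 != 0
     & forall a', (a' < ab.1)%N -> (d - a' < q)%N -> (s * G)`_a' = 0])
  (ab \in init_hom).
Proof.
case: ab => a b /= abd; apply: (iffP (@initialsP _ q (homogenize e G) (a, b))) => /= [[u [uab u0]]|].
  move: uab; rewrite coefM_homogenize // abd; case: leqP => [ed uab|]; last by rewrite eqxx.
  split=> //; exists (graded_part (d - e) u); split => [|//|a' a'a da'].
    exact: size_poly.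
  have := u0 a' (d - a')%N (ltn_trans a'a (ltn_ord a)) da'.
  rewrite ltn_index ?a'a // => /(_ isT); rewrite coefM_homogenize // ifT; last lia.
  by rewrite subnKC //; lia.
case=> ed [s [sd sab s0]]; exists (homogenize (d - e) s).
have sG : (size (s * G)%R <= d.+1)%N by rewrite -(subnK ed) size_mul_le.
rewrite homogenizeM // subnK //; split; first by rewrite coef_homogenize // abd eqxx.
move=> a' b' a'q b'q; rewrite ltn_index // coef_homogenize //.
case: (eqVneq (a' + b')%N d) => // a'b'd; have -> : b' = (d - a')%N by lia.
case/orP => [a'a|]; last lia.
by rewrite s0 //; lia.
Qed.

(** The matrix, in monomial bases, of multiplication by the form from degree
    d - e to degree d modulo (x^q, y^q); columns outside the window
    d - q < a <= d are zero since they index no monomial of that degree in the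
    box. *)
Definition band d : 'M[k]_((d - e).+1, q) := \matrix_(i, a)
  (if (a <= d < q + a)%N then ('X^i * G)`_a else 0).

Lemma coef_rVpolyM m (u : 'rV_m) a :
  (rVpoly u * G)`_a = \sum_i u 0 i * ('X^i * G)`_a.
Proof.
have -> : rVpoly u = \sum_i u 0 i *: 'X^i.
  apply/polyP => j; rewrite coef_sum /rVpoly coef_poly.
  case: ltnP => jd.
    rewrite insubT /= (bigD1 (Ordinal jd)) //= coefZ coefXn eqxx mulr1.
    rewrite big1 ?addr0 // => i ij; rewrite coefZ coefXn.
    by rewrite -[j]/(val (Ordinal jd)) (inj_eq val_inj) eq_sym (negPf ij) mulr0.
  rewrite big1 // => i _; rewrite coefZ coefXn gtn_eqF ?mulr0 //.
  exact: leq_trans jd.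
by rewrite mulr_suml coef_sum; apply: eq_bigr => i _; rewrite -scalerAl coefZ.
Qed.

Lemma band_mul d (u : 'rV_(d - e).+1) (a : 'I_q) :
  (u *m band d) 0 a = if (a <= d < q + a)%N then (rVpoly u * G)`_a else 0.
Proof.
rewrite mxE; case: ifP => win; last first.
  by rewrite big1 // => i _; rewrite mxE win mulr0.
by rewrite coef_rVpolyM; apply: eq_bigr => i _; rewrite mxE win.
Qed.

Lemma init_deg_lead d : (e <= d)%N -> [set ab.1 | ab in init_deg d] = lead_set (band d).
Proof.
move=> ed; apply/setP => a; apply/imsetP/lead_setP => [[[a1 b1]]|[u [ua u0]]].
  rewrite inE /= => /andP[+ /eqP abd] ->.
  move=> /(@mem_init_hom (a1, b1) _ abd)[_ [s [sd sab s0]]].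
  have b1q := ltn_ord b1.
  exists (poly_rV s); rewrite band_mul poly_rV_K // ifT; last lia.
  split=> // a' a'a; rewrite band_mul poly_rV_K //; case: ifP => // win.
  by rewrite s0 //; lia.
move: ua; rewrite band_mul; case: ifP => [win ua|]; last by rewrite eqxx.
have dq : (d - a < q)%N by lia.
have abd : ((a, Ordinal dq).1 + (a, Ordinal dq).2 = d)%N by rewrite /=; lia.
exists (a, Ordinal dq) => //; rewrite inE abd eqxx andbT.
apply/(@mem_init_hom (a, Ordinal dq) _ abd); split => //; exists (rVpoly u); split => //=.
  exact: size_poly.
move=> a' a'a da'q; have a'q := ltn_trans a'a (ltn_ord a).
have := u0 (Ordinal a'q) a'a; rewrite band_mul ifT //=; lia.
Qed.

Lemma init_deg_inj d : {in init_deg d &, injective (fun ab => ab.1)}.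
Proof.
move=> [a b] [a' b']; rewrite !inE /= => /andP[_ /eqP abd] /andP[_ /eqP abd'] aa'.
by rewrite aa' in abd *; congr (_, _); apply: val_inj => /=; lia.
Qed.

Lemma card_init_deg_le d : (e <= d)%N -> (#|init_deg d| <= (d - e).+1)%N.
Proof.
move=> ed; rewrite -(card_in_imset (@init_deg_inj d)) init_deg_lead //.
exact: card_lead_set_le.
Qed.

Lemma card_init_deg_lt d : (d < e)%N -> #|init_deg d| = 0%N.
Proof.
move=> de; apply/eqP; rewrite cards_eq0; apply/eqP/setP => ab; rewrite [RHS]finset.in_set0 finset.in_set.
apply/negbTE/negP => /andP[ab_in /eqP abd].
by have [] := elimT (mem_init_hom abd) ab_in; lia.
Qed.

Lemma card_init_deg_box d : (#|init_deg d| <= 2 * q - 1 - d)%N.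
Proof.
rewrite -(card_in_imset (@init_deg_inj d)).
apply: leq_trans (card_ord_geq q _); rewrite subset_leq_card //.
apply/fintype.subsetP => _ /imsetP[[a b] + ->]; rewrite !inE /= => /andP[_ /eqP abd].
by have := ltn_ord b; have := ltn_ord a; lia.
Qed.

(** Injectivity of multiplication by the form from degree j to degree e + j
    modulo (x^q, y^q). *)
Definition band_injective j := forall s, s != 0 -> (size s <= j.+1)%N ->
  exists a, [/\ (e + j < q + a)%N, (a < q)%N & (s * G)`_a != 0].

Lemma card_init_deg_low j : band_injective j -> (#|init_deg (e + j)| >= j.+1)%N.
Proof.
move=> inj_j; rewrite -(card_in_imset (@init_deg_inj _)) init_deg_lead ?leq_addr //.
apply: leq_trans (card_lead_set_ge _).
suff /eqP -> : row_free (band (e + j)) by rewrite addKn.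
apply/inj_row_free => u uT; apply/eqP/negPn/negP => u0.
have su0 : rVpoly u != 0.
  by apply: contraNneq u0 => H; rewrite -[u]rVpolyK H linear0.
have sj : (size (rVpoly u) <= j.+1)%N by apply: leq_trans (size_poly _ _) _; lia.
have [a [ea aq sa]] := inj_j _ su0 sj.
have : (u *m band (e + j)) 0 (Ordinal aq) = 0 by rewrite uT mxE.
rewrite band_mul ifT /=; first by move/eqP; rewrite (negPf sa).
rewrite ea andbT -ltnS; apply: contraTT sa; rewrite -leqNgt => eja.
rewrite nth_default ?eqxx // (leq_trans _ eja) //.
by apply: leq_trans (size_mul_le sj Ge) _; lia.
Qed.

(** Pairing with the socle monomial (x y)^(q-1), the matrix from degree
    2 q - 2 - j - e to degree 2 q - 2 - j is the transpose of the matrix from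
    degree j to degree e + j.  Injectivity of the latter thus makes every
    monomial of degree 2 q - 2 - j in the box an initial monomial. *)
Lemma card_init_deg_high j : (j < q)%N -> (e + j.+1 <= 2 * q - 1 - j)%N ->
  band_injective j -> (#|init_deg (2 * q - 2 - j)| >= j.+1)%N.
Proof.
move=> jq ejq inj_j; set d := (2 * q - 2 - j)%N.
have ed : (e <= d)%N by lia.
(* The entry (i, a') only depends on i + a': it is the coefficient of G at
   q - 1 - i - a'. *)
pose B : 'M[k]_(j.+1, (d - e).+1) := \matrix_(i, a') ('X^a' * G)`_(q.-1 - i).
have B_mul (u : 'rV_j.+1) (a' : 'I_(d - e).+1) : (a' < q)%N ->
    (u *m B) 0 a' = (rVpoly u * G)`_(q.-1 - a').
  move=> a'q; rewrite mxE coef_rVpolyM; apply: eq_bigr => i _; rewrite mxE.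
  have ij := ltn_ord i; rewrite !coefXnM.
  have -> : (q.-1 - i < a')%N = (q.-1 - a' < i)%N by lia.
  by case: ifP => // _; congr (_ * _`_ _); lia.
have B_mulr (w : 'cV_(d - e).+1) i : (B *m w) i 0 = (rVpoly w^T * G)`_(q.-1 - i).
  by rewrite mxE coef_rVpolyM; apply: eq_bigr => a _; rewrite !mxE mulrC.
have /row_freeP[C BC] : row_free B.
  apply/inj_row_free => u uB; apply/eqP/negPn/negP => u0.
  have su0 : rVpoly u != 0.
    by apply: contraNneq u0 => H; rewrite -[u]rVpolyK H linear0.
  have [a [ea aq sa]] := inj_j _ su0 (size_poly _ _).
  have a'd : (q.-1 - a < (d - e).+1)%N by lia.
  have := B_mul u (Ordinal a'd); rewrite uB mxE /= subKn; last lia.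
  by move=> H; rewrite -H ?eqxx // in sa; lia.
rewrite -(card_in_imset (@init_deg_inj d)) -[X in (X <= _)%N](card_ord j.+1) -cardsT.
have rev_q (i : 'I_j.+1) : (q.-1 - i < q)%N by lia.
have rev_inj : injective (fun i : 'I_j.+1 => Ordinal (rev_q i)).
  by move=> i i' [ii']; apply: val_inj => /=; have := ltn_ord i; have := ltn_ord i'; lia.
rewrite -(card_imset _ rev_inj) subset_leq_card //.
apply/fintype.subsetP => _ /imsetP[i _ ->]; apply/imsetP.
have ij := ltn_ord i; have bq : (d - (q.-1 - i) < q)%N by lia.
have abd : (Ordinal (rev_q i) + Ordinal bq = d)%N by rewrite /=; lia.
exists (Ordinal (rev_q i), Ordinal bq) => //; rewrite finset.in_set /= abd eqxx andbT.
apply/(@mem_init_hom (Ordinal (rev_q i), Ordinal bq) _ abd); split=> //=.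
pose w := col i C; exists (rVpoly w^T).
have wG (i' : 'I_j.+1) : (rVpoly w^T * G)`_(q.-1 - i') = (i' == i)%:R.
  rewrite -B_mulr; have -> : (B *m w) i' 0 = (B *m C) i' i.
    by rewrite !mxE; apply: eq_bigr => l _; rewrite [w _ _]mxE.
  by rewrite BC mxE.
split; first exact: size_poly.
  by rewrite wG eqxx oner_eq0.
move=> a' a'i da'q; have i'j : (q.-1 - a' < j.+1)%N by lia.
have := wG (Ordinal i'j); rewrite /= subKn; last lia.
move=> ->; case: eqP => // /(congr1 val) /=; lia.
Qed.

Lemma card_init_homE : #|init_hom| = (\sum_(0 <= d < 2 * q - 1) #|init_deg d|)%N.
Proof.
rewrite big_mkord -sum1_card.
transitivity (\sum_(ab in init_hom) \sum_(d < 2 * q - 1) (ab.1 + ab.2 == d)%N)%N.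
  apply: eq_bigr => -[a b] _ /=; have abq : (a + b < 2 * q - 1)%N.
    by have := ltn_ord a; have := ltn_ord b; lia.
  rewrite (bigD1 (Ordinal abq)) //= eqxx big1 // => d dab.
  by case: eqP => // abd; case/eqP: dab; apply: val_inj.
rewrite exchange_big; apply: eq_bigr => d _ /=.
rewrite -sum1_card big_mkcond [RHS]big_mkcond; apply: eq_bigr => ab _ /=.
by rewrite [in RHS]finset.in_set; case: (ab \in init_hom) => //=; case: eqP.
Qed.

Lemma sum_succ h : (2 * \sum_(0 <= j < h) j.+1 = h * h.+1)%N.
Proof.
elim: h => [|h IHh]; first by rewrite big_geq.
by rewrite big_nat_recr //= mulnDr IHh; lia.
Qed.

Lemma sum_top (F : nat -> nat) D c : (c <= D)%N ->
  (\sum_(D - c <= d < D) F d = \sum_(0 <= j < c) F (D - 1 - j))%N.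
Proof.
elim: c => [|c IHc] cD; first by rewrite subn0 !big_geq.
rewrite big_ltn; last lia; rewrite big_nat_recr //= addnC -IHc ?(ltnW cD) //.
by rewrite -subnDA add1n -subSn // subSS.
Qed.

Lemma sum_bottom (F : nat -> nat) a c :
  (\sum_(a <= d < a + c) F d = \sum_(0 <= j < c) F (a + j))%N.
Proof.
rewrite -{1}[a]add0n big_addn addKn.
by apply: eq_bigr => j _; rewrite addnC.
Qed.

(** Degrees e + j and 2 q - 2 - j, for j < c, are distinct and contribute at
    least j + 1 each. *)
Lemma card_initials_homogeneous_ge c : (c <= q)%N -> (e + 2 * c < 2 * q)%N ->
  (forall j, (j < c)%N -> band_injective j) -> (c * c.+1 <= #|init_hom|)%N.
Proof.
move=> cq ec inj; have [->//|c_gt0] := posnP c.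
rewrite card_init_homE -sum_succ mul2n -addnn.
rewrite (@big_cat_nat _ _ _ e 0 (2 * q - 1)) /=; [|lia|lia].
rewrite (@big_cat_nat _ _ _ (e + c) e (2 * q - 1)) /=; [|lia|lia].
rewrite (@big_cat_nat _ _ _ (2 * q - 1 - c) (e + c) (2 * q - 1)) /=; [|lia|lia].
rewrite (leq_trans _ (leq_addl _ _)) // leq_add //.
  rewrite sum_bottom big_nat [leqRHS]big_nat leq_sum // => j /andP[_ jc].
  exact/card_init_deg_low/inj.
rewrite (leq_trans _ (leq_addl _ _)) // sum_top; last lia.
rewrite big_nat [leqRHS]big_nat leq_sum // => j /andP[_ jc].
have -> : (2 * q - 1 - 1 - j = 2 * q - 2 - j)%N by lia.
by apply: card_init_deg_high; [lia|lia|exact: inj].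
Qed.

(** The count in degree d is at most min (d - e + 1, 2 q - 1 - d); the two bounds
    cross near d = e + (2 q - e) / 2. *)
Lemma card_initials_homogeneous_le : (e <= 2 * q)%N -> (4 * #|init_hom| <= (2 * q - e) ^ 2)%N.
Proof.
move=> e2q; have [small|big] := leqP (2 * q - 1) e.
  rewrite card_init_homE big_nat big1 // => d /andP[_ dq].
  by rewrite card_init_deg_lt //; lia.
pose M := (2 * q - e)%N; pose h := M./2; pose c := (2 * q - 1 - (e + h))%N.
have ME := odd_double_half M; rewrite -/h in ME.
have hM : (h <= M)%N by lia.
have total : (2 * #|init_hom| <= h * h.+1 + c * c.+1)%N.
  rewrite card_init_homE -!sum_succ -mulnDr leq_mul2l /=.
  rewrite (@big_cat_nat _ _ _ e 0 (2 * q - 1)) /=; [|lia|lia].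
  rewrite (@big_cat_nat _ _ _ (e + h) e (2 * q - 1)) /=; [|lia|lia].
  rewrite big_nat big1 ?add0n => [|d /andP[_ de]]; last exact: card_init_deg_lt.
  rewrite leq_add //.
    rewrite sum_bottom big_nat [leqRHS]big_nat leq_sum // => j /andP[_ jh].
    by apply: leq_trans (card_init_deg_le _) _; lia.
  have -> : (e + h = 2 * q - 1 - c)%N by lia.
  rewrite sum_top; last lia.
  rewrite big_nat [leqRHS]big_nat leq_sum // => j /andP[_ jc].
  by apply: leq_trans (card_init_deg_box _) _; lia.
rewrite -/M; have cE : (c = M - 1 - h)%N by lia.
move: total ME; rewrite cE; case: (odd M) => total ME; nia.
Qed.

End Graded.

Local Open Scope classical_set_scope.
Local Open Scope ring_scope.

(** * From k[x,y] to its localization at the origin *)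
Section Bridge.
Variable k : fieldType.
Implicit Types (g h : {mpoly k[2]}) (u v : bipoly k).

Definition bivar (i : 'I_2) : bipoly k := if i == ord0 then 'X else 'X%:P.

Definition bipoly_of g : bipoly k := mmap (polyC \o polyC) bivar g.

Fact bipoly_of_is_zmod_morphism : zmod_morphism bipoly_of.
Proof. exact: mmapB. Qed.
Fact bipoly_of_is_monoid_morphism : monoid_morphism bipoly_of.
Proof. split; [exact: rmorph1|exact: rmorphM]. Qed.

HB.instance Definition _ := GRing.isZmodMorphism.Build {mpoly k[2]} (bipoly k)
  bipoly_of bipoly_of_is_zmod_morphism.
HB.instance Definition _ := GRing.isMonoidMorphism.Build {mpoly k[2]} (bipoly k)
  bipoly_of bipoly_of_is_monoid_morphism.

Definition mnm2 (a b : nat) : 'X_{1..2} :=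
  [multinom (if i == ord0 then a else b) | i < 2].

Lemma bipoly_ofC c : bipoly_of c%:MP = c%:P%:P.
Proof. exact: mmapC. Qed.

Lemma bipoly_ofX i : bipoly_of 'X_i = bivar i.
Proof. by rewrite /bipoly_of mmapX mmap1U. Qed.

Lemma coef_bipoly_of g a b : (bipoly_of g)`_a`_b = g@_(mnm2 a b).
Proof.
rewrite [in RHS](mpolyE g) raddf_sum /= /bipoly_of /mmap !coef_sum.
apply: eq_bigr => m _; rewrite mcoeffZ mcoeffX.
rewrite /= coefCM coefCM; congr (_ * _).
rewrite /mmap1 big_ord_recl big_ord1 /bivar /=.
have -> : (m == mnm2 a b) = (a == m ord0) && (b == m (lift ord0 ord0)).
  apply/eqP/andP => [->|[/eqP am /eqP bm]]; first by rewrite !mnmE !eqxx.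
  apply/mnmP => i; rewrite mnmE; case: eqP => [->//|/eqP i0].
  rewrite bm; congr (m _); apply: val_inj.
  by case: i i0 => -[|[|i]].
rewrite -polyC_exp coefMC coefXn; case: eqP => _; rewrite ?mul0r ?coef0 //.
by rewrite mul1r coefXn.
Qed.

Lemma bipoly_of_inj : injective bipoly_of.
Proof.
move=> g h gh; apply/mpolyP => m.
have -> : m = mnm2 (m ord0) (m (lift ord0 ord0)).
  apply/mnmP => i; rewrite mnmE; case: eqP => [->//|/eqP i0].
  by congr (m _); apply: val_inj; case: i i0 => -[|[|i]].
by rewrite -!coef_bipoly_of gh.
Qed.

Lemma bipoly_of_surj u : exists g, bipoly_of g = u.
Proof.
elim/poly_ind: u => [|u c [g <-]]; first by exists 0; rewrite rmorph0.
have [h <-] : exists h, bipoly_of h = c%:P.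
  elim/poly_ind: c => [|c a [h ch]]; first by exists 0; rewrite rmorph0.
  exists (h * 'X_(lift ord0 ord0) + a%:MP).
  by rewrite rmorphD rmorphM /= bipoly_ofX bipoly_ofC ch polyCD polyCM.
by exists (g * 'X_ord0 + h); rewrite rmorphD rmorphM /= bipoly_ofX.
Qed.

Lemma xy_ideal_bipolyE g : (g \in @xy_ideal k) = ((bipoly_of g)`_0`_0 == 0).
Proof.
rewrite xy_idealE coef_bipoly_of; congr (g@_ _ == 0).
by apply/mnmP => i; rewrite !mnmE if_same.
Qed.

Local Notation R := (plane_local_ring k).
Local Notation loc := (@plane_local k).

Fact plane_local_is_zmod_morphism : zmod_morphism loc.
Proof. by move=> g h; apply: val_inj; rewrite rmorphB /= tofracB. Qed.
Fact plane_local_is_monoid_morphism : monoid_morphism loc.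
Proof.
by split=> [|g h]; apply: val_inj; rewrite ?rmorph1 ?rmorphM /= ?tofrac1 ?tofracM.
Qed.

HB.instance Definition _ := GRing.isZmodMorphism.Build {mpoly k[2]} R
  loc plane_local_is_zmod_morphism.
HB.instance Definition _ := GRing.isMonoidMorphism.Build {mpoly k[2]} R
  loc plane_local_is_monoid_morphism.

Lemma plane_local_inj : injective loc.
Proof. by move=> g h /(congr1 val) /= /eqP; rewrite tofrac_eq => /eqP. Qed.

(** The fraction z = a / b, with b invertible at the origin. *)
Definition fraction_of (z : R) a b :=
  (bipoly_of b)`_0`_0 != 0 /\ z * loc b = loc a.

Lemma fraction_exists z : exists a b, fraction_of z a b.
Proof.
case: z => z zP; have /asboolP[a [b [bP zE]]] := zP; exists a, b.
split; first by rewrite -xy_ideal_bipolyE.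
apply: val_inj; rewrite rmorphM /= zE divfK // tofrac_eq0.
by apply: contraNneq bP => ->; rewrite idealr0.
Qed.

Lemma plane_local_unit b : (bipoly_of b)`_0`_0 != 0 -> exists z, z * loc b = 1.
Proof.
move=> b0; have bP : b \notin @xy_ideal k by rewrite xy_ideal_bipolyE.
have zP : (FracField.tofrac b)^-1 \in local_pred (@xy_ideal k).
  by apply/asboolP; exists 1, b; rewrite tofrac1 mul1r.
exists (Localization zP); apply: val_inj; rewrite rmorphM rmorph1 /= mulVf //.
by rewrite tofrac_eq0; apply: contraNneq bP => ->; rewrite idealr0.
Qed.

End Bridge.

(** * Frobenius powers of the maximal ideal *)
Lemma mem_ideal_gen (A : comNzRingType) (S : set A) (a : A) : S a -> a \in ideal_gen S.
Proof.
move=> Sa; apply/asboolP; exists 1%N, (fun=> 1), (fun=> a).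
by split=> //; rewrite big_ord1 mul1r.
Qed.

Section Order.
Variable k : fieldType.
Implicit Types (g h : {mpoly k[2]}) (u v : bipoly k).
Local Notation R := (plane_local_ring k).
Local Notation loc := (@plane_local k).
Implicit Types (z w : R).

(** The extension to the local ring of the filtration by monomial ideals; by
    [vanishes_below_unit] any fraction representing z tests membership. *)
Definition local_vanishes q T z := exists a b,
  fraction_of z a b /\ vanishes_below q T (bipoly_of a).

Lemma local_vanishesE q T z a b : fraction_of z a b ->
  local_vanishes q T z <-> vanishes_below q T (bipoly_of a).
Proof.
move=> [b0 zb]; split=> [[a' [b' [[b'0 zb'] a'T]]]|aT]; last by exists a, b.
apply: (@vanishes_below_unit _ _ _ (bipoly_of b')) => //; rewrite -rmorphM /=.
have -> : b' * a = b * a'.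
  by apply: plane_local_inj; rewrite !rmorphM /= -zb -zb' mulrCA [RHS]mulrCA [loc b' * _]mulrC.
by rewrite rmorphM; exact: vanishes_below_mull.
Qed.

Lemma fraction_ofM z w a b c d : fraction_of z a b -> fraction_of w c d ->
  fraction_of (z * w) (a * c) (b * d).
Proof.
move=> [b0 zb] [d0 wd]; split; last by rewrite !rmorphM /= mulrACA zb wd.
by rewrite rmorphM /= !coef0M mulf_neq0.
Qed.

Lemma fraction_ofD z w a b c d : fraction_of z a b -> fraction_of w c d ->
  fraction_of (z + w) (a * d + c * b) (b * d).
Proof.
move=> [b0 zb] [d0 wd]; split; first by rewrite rmorphM /= !coef0M mulf_neq0.
by rewrite mulrDl rmorphD !rmorphM /= mulrA zb [loc b * _]mulrC mulrA wd.
Qed.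

Lemma fraction_of_loc a : fraction_of (loc a) a 1.
Proof. by rewrite /fraction_of !rmorph1 mulr1 !coef1 oner_eq0. Qed.

Lemma fraction_ofX z a b n : fraction_of z a b -> fraction_of (z ^+ n) (a ^+ n) (b ^+ n).
Proof.
move=> zab; elim: n => [|n IHn]; first by rewrite !expr0 -(rmorph1 loc); exact: fraction_of_loc.
by rewrite !exprS; exact: fraction_ofM.
Qed.

Lemma local_vanishes_loc q T a : local_vanishes q T (loc a) <-> vanishes_below q T (bipoly_of a).
Proof. exact/local_vanishesE/fraction_of_loc. Qed.

Lemma local_vanishes0 q T : local_vanishes q T 0.
Proof.
rewrite -(rmorph0 loc); apply/local_vanishes_loc; rewrite rmorph0 => a b _ _ _.
by rewrite !coef0.
Qed.

Lemma local_vanishesD q T z w :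
  local_vanishes q T z -> local_vanishes q T w -> local_vanishes q T (z + w).
Proof.
move=> [a [b [zab aT]]] [c [d [wcd cT]]].
exists (a * d + c * b), (b * d); split; first exact: fraction_ofD.
rewrite rmorphD !rmorphM /= [bipoly_of a * _]mulrC [bipoly_of c * _]mulrC.
by apply: vanishes_belowD; apply: vanishes_below_mull.
Qed.

Lemma local_vanishesM q T z w : local_vanishes q T w -> local_vanishes q T (z * w).
Proof.
have [a [b zab]] := fraction_exists z; move=> [c [d [wcd cT]]].
exists (a * c), (b * d); split; first exact: fraction_ofM.
by rewrite rmorphM; exact: vanishes_below_mull.
Qed.

Lemma local_vanishes_le q T1 T2 z : (T1 <= T2)%N ->
  local_vanishes q T2 z -> local_vanishes q T1 z.
Proof.
by move=> le [a [b [zab aT]]]; exists a, b; split=> //; exact: vanishes_below_le aT.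
Qed.

Variable p : nat.
Hypothesis pk : p \in [pchar k].
Let p_gt0 : (0 < p)%N. Proof. by rewrite prime_gt0 // (pcharf_prime pk). Qed.

(** A p^e-th power has exponents divisible by p^e, so within the box only its
    constant term can survive. *)
Lemma vanishes_below_Xp u e : u`_0`_0 = 0 ->
  vanishes_below (p ^ e) (p ^ e * p ^ e) (u ^+ (p ^ e)).
Proof.
move=> u0; elim: e => [|e IHe] a b aq bq _.
  by move: aq bq; rewrite expn0 expr1; case: a => // _; case: b.
rewrite expnSr exprM (coefXp2 pk); case: ifP => // _.
have aq' : (a %/ p < p ^ e)%N by rewrite ltn_divLR // -expnSr.
have bq' : (b %/ p < p ^ e)%N by rewrite ltn_divLR // -expnSr.
by rewrite IHe ?expr0n ?eqn0Ngt ?p_gt0 //; nia.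
Qed.

Lemma plane_max_idealP z : z \in @plane_max_ideal k <-> local_vanishes 1 1 z.
Proof.
split=> [/asboolP[n [c [g [gX ->]]]]|[a [b [[b0 zb] a0]]]].
  apply: (big_ind (local_vanishes 1 1)); [exact: local_vanishes0|exact: local_vanishesD|].
  move=> i _; apply: local_vanishesM; have [j _ <-] := gX i; apply/local_vanishes_loc.
  move=> a b; rewrite !ltnS !leqn0 => /eqP-> /eqP-> _.
  by rewrite bipoly_ofX /bivar; case: ifP => _; rewrite ?coefX ?coefC ?coef0 ?coefX.
have [w wb] := plane_local_unit b0.
have -> : z = w * loc a by rewrite -zb mulrCA wb mulr1.
have : a \in @xy_ideal k by rewrite xy_ideal_bipolyE a0.
case/asboolP => n [c [g [gX ->]]]; rewrite rmorph_sum /=.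
apply: (@rpredZ _ _ (@plane_max_ideal k) w); apply: rpred_sum => i _.
rewrite rmorphM /=; apply: (@rpredZ _ _ (@plane_max_ideal k)).
by have [j _ <-] := gX i; apply: mem_ideal_gen; exists j.
Qed.

Lemma mem_frobenius_power q z : z \in @plane_max_ideal k -> 
  z ^+ q \in frobenius_power (@plane_max_ideal k) q.
Proof. by move=> zm; apply: mem_ideal_gen; exists z. Qed.

Lemma frobenius_powerP e z :
  z \in frobenius_power (@plane_max_ideal k) (p ^ e) <->
  local_vanishes (p ^ e) (p ^ e * p ^ e) z.
Proof.
set q := (p ^ e)%N; split=> [/asboolP[n [c [g [gX ->]]]]|[a [b [[b0 zb] a0]]]].
  apply: (big_ind (local_vanishes q (q * q))); [exact: local_vanishes0|exact: local_vanishesD|].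
  move=> i _; apply: local_vanishesM; have [w wm <-] := gX i.
  have [c' [d [wcd c0]]] := (plane_max_idealP w).1 wm.
  apply/(local_vanishesE _ _ (fraction_ofX q wcd)).
  by rewrite rmorphXn; apply: vanishes_below_Xp; exact: c0.
have [w wb] := plane_local_unit b0.
have -> : z = w * loc a by rewrite -zb mulrCA wb mulr1.
apply: (@rpredZ _ _ (frobenius_power (@plane_max_ideal k) q) w).
have [c cE] := bipoly_of_surj (drop_poly q (bipoly_of a)).
have [d dE] := bipoly_of_surj (\poly_(i < q) drop_poly q (bipoly_of a)`_i).
have -> : a = c * 'X_ord0 ^+ q + d * 'X_(lift ord0 ord0) ^+ q.
  apply: bipoly_of_inj; rewrite rmorphD !rmorphM !rmorphXn /= !bipoly_ofX cE dE /bivar /=.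
  rewrite -[LHS](poly_take_drop q) addrC; congr (_ + _).
  apply/polyP => i; rewrite coef_take_poly -polyC_exp coefMC coef_poly.
  case: ltnP => iq; last by rewrite mul0r.
  rewrite -[LHS](poly_take_drop q) -[RHS]add0r; congr (_ + _).
  apply/polyP => j; rewrite coef_take_poly coef0; case: ltnP => jq //.
  by rewrite a0 //; nia.
have Xm i : loc 'X_i \in @plane_max_ideal k by apply: mem_ideal_gen; exists i.
rewrite rmorphD !rmorphM !rmorphXn /=; apply: rpredD;
  by apply: (@rpredZ _ _ (frobenius_power (@plane_max_ideal k) q));
     apply: mem_frobenius_power.
Qed.

End Order.

(** * Lengths as numbers of initial monomials *)
Lemma index_injective q a b a' b' : (b < q)%N -> (b' < q)%N ->
  (a * q + b = a' * q + b')%N -> a = a' /\ b = b'.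
Proof.
move=> bq b'q E; have q_gt0 : (0 < q)%N by exact: leq_ltn_trans bq.
split; [have := congr1 (divn^~ q) E | have := congr1 (modn^~ q) E].
  by rewrite !divnMDl // !divn_small // !addn0.
by rewrite !modnMDl !modn_small.
Qed.

Lemma coef_bipoly_of_subZ (k : fieldType) (c : k) (s s' g : {mpoly k[2]}) a b :
  (bipoly_of ((s - c%:MP * s') * g))`_a`_b =
  (bipoly_of (s * g))`_a`_b - c * (bipoly_of (s' * g))`_a`_b.
Proof.
by rewrite !coef_bipoly_of mulrBl -mulrA mcoeffB mcoeffCM.
Qed.

Section Class.
Local Open Scope quotient_scope.
Variables (A : comNzRingType) (I : ideal A).

Definition class_of (a : A) : quotient_module I := \pi a.

Lemma class_ofD a b : class_of (a + b) = class_of a + class_of b.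
Proof. exact: pi_quotientD. Qed.

Lemma class_ofM a b : class_of (a * b) = a *: class_of b.
Proof. exact: pi_quotient_scale. Qed.

Lemma class_of_surj v : class_of (repr v) = v.
Proof. exact: reprK. Qed.

Lemma class_of_eq a b : (class_of a = class_of b) <-> (a - b : A) \in I.
Proof.
have := Quotient.idealrBE (submod_zmod_pred I) a b; rewrite inE => E.
by rewrite E; split => [H|/eqP H]; [apply/eqP|].
Qed.

End Class.

Section Length.
Variables (k : fieldType) (p : nat).
Hypothesis pk : p \in [pchar k].
Local Notation R := (plane_local_ring k).
Local Notation loc := (@plane_local k).
Variables (e : nat) (g : {mpoly k[2]}).
Local Notation q := (p ^ e)%N.
Local Notation I := (colon (frobenius_power (@plane_max_ideal k) q) (loc g)).
Local Notation Q := (quotient_module I).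
Local Notation cls := (class_of I).

Lemma class_of_eqP z w : (cls z = cls w) <-> local_vanishes q (q * q) ((z - w) * loc g).
Proof. by rewrite class_of_eq -(frobenius_powerP pk). Qed.

(** The submodule of Q where multiplication by g lands in the T-th step of the
    filtration.  Truncating T at q^2 makes this independent of the chosen
    representative. *)
Definition level T : {pred Q} :=
  [pred v : Q | `[< local_vanishes q (minn T (q * q)) (repr v * loc g) >]].

Lemma mem_level T z : (T <= q * q)%N ->
  (cls z \in level T) <-> local_vanishes q T (z * loc g).
Proof.
move=> Tq; have /class_of_eqP/(local_vanishes_le Tq) d := class_of_surj (cls z).
have /esym/class_of_eqP/(local_vanishes_le Tq) d' := class_of_surj (cls z).
rewrite inE /= (minn_idPl Tq).
split=> H.
  by have := local_vanishesD d' H; rewrite -mulrDl subrK.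
by have := local_vanishesD d H; rewrite -mulrDl subrK.
Qed.

Lemma level_min T : level T = level (minn T (q * q)).
Proof. by rewrite /level -minnA minnn. Qed.

Fact level_submod_closed T : submod_closed (level T).
Proof.
rewrite level_min; have Tq := geq_minr T (q * q).
have cls0 : (0 : Q) = cls 0 by rewrite -[in RHS](mulr0 0) class_ofM scale0r.
split; first by rewrite cls0; apply/(mem_level _ Tq); rewrite mul0r; exact: local_vanishes0.
move=> a u v; rewrite -(class_of_surj u) -(class_of_surj v).
move: (repr u) (repr v) => {u v} z w /(mem_level _ Tq) zT /(mem_level _ Tq) wT.
rewrite -class_ofM -class_ofD; apply/(mem_level _ Tq); rewrite mulrDl -mulrA.
by apply: local_vanishesD => //; exact: local_vanishesM.
Qed.

HB.instance Definition _ T := GRing.isSubmodClosed.Build R Q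
  (level T) (GRing.submod_closed_semi (level_submod_closed T)).

Definition module_initials (N : submodClosed Q) : {set 'I_q * 'I_q} :=
  [set ab : 'I_q * 'I_q | `[< exists s, cls (loc s) \in N /\
    initial_at q (bipoly_of (s * g)) ab.1 ab.2 >]].

Lemma module_initialsP (N : submodClosed Q) (ab : 'I_q * 'I_q) : reflect (exists s, cls (loc s) \in N /\
    initial_at q (bipoly_of (s * g)) ab.1 ab.2) (ab \in module_initials N).
Proof. by rewrite finset.in_set; exact: asboolP. Qed.

Lemma module_initials_sub (N : submodClosed Q) : module_initials N \subset initials q (bipoly_of g).
Proof.
apply/fintype.subsetP => ab; move=> /module_initialsP[s [_ sab]]; apply/initialsP.
by exists (bipoly_of s); rewrite -rmorphM.
Qed.

Lemma mem_fraction (N : submodClosed Q) z a b : fraction_of z a b ->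
  (cls z \in N) = (cls (loc a) \in N).
Proof.
move=> [b0 zb]; have [w wb] := plane_local_unit b0.
apply/idP/idP => H; first by rewrite -zb mulrC class_ofM rpredZ.
by rewrite -[z]mulr1 -wb mulrCA zb class_ofM rpredZ.
Qed.

(** If N1 and N2 had the same initial monomials, one could cancel initial terms of
    an element of N2 outside N1 by elements of N1 until it vanished in Q. *)
Lemma module_initials_proper (N1 N2 : submodClosed Q) :
  [set` N1] `<` [set` N2] -> (#|module_initials N1| < #|module_initials N2|)%N.
Proof.
case=> N12 N21; have [v [vN2 vN1]] : exists v, v \in N2 /\ v \notin N1.
  apply: contrapT => H; apply: N21 => v /= vN2; apply: contrapT => /negP vN1.
  by apply: H; exists v.
rewrite proper_card // properE; apply/andP; split.
  apply/fintype.subsetP => ab; move=> /module_initialsP[s [sN1 sab]]; apply/module_initialsP.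
  by exists s; split=> //; exact: (N12 _ sN1).
apply/negP => /fintype.subsetP initN.
suff H T : (T <= q * q)%N -> exists s, [/\ cls (loc s) \in N2, cls (loc s) \notin N1 &
    vanishes_below q T (bipoly_of (s * g))].
  have [s [sN2 sN1 s0]] := H _ (leqnn _).
  case/negP: sN1; have -> : cls (loc s) = 0; last exact: rpred0.
  have -> : (0 : Q) = cls 0 by rewrite -[in RHS](mulr0 0) class_ofM scale0r.
  by apply/class_of_eqP; rewrite subr0 -rmorphM; apply/local_vanishes_loc.
elim: T => [_|T IHT Tq].
  have [a [b vab]] := fraction_exists (repr v).
  by exists a; rewrite -!(mem_fraction _ vab) !class_of_surj; split.
have [s [sN2 sN1 s0]] := IHT (ltnW Tq).
have [sT|/not_vanishes_below_initial] := pselect (vanishes_below q T.+1 (bipoly_of (s * g))).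
  by exists s.
case=> a [b [aq bq abT [sab sab0]]].
have abE : (a * q + b = T)%N.
  apply/eqP; rewrite eqn_leq -ltnS abT /= leqNgt; apply/negP => /(s0 _ _ aq bq).
  by move/eqP; rewrite (negPf sab).
have : (Ordinal aq, Ordinal bq) \in module_initials N1.
  by apply: initN; apply/module_initialsP; exists s.
move=> /module_initialsP[s' /= [s'N1 [s'ab s'0]]].
pose c := (bipoly_of (s * g))`_a`_b / (bipoly_of (s' * g))`_a`_b.
have cs'N (N : submodClosed Q) : cls (loc s') \in N -> cls (loc (c%:MP * s')) \in N.
  by move=> H; rewrite rmorphM class_ofM rpredZ.
exists (s - c%:MP * s'); split.
- rewrite rmorphB /= -[loc _ - _]/(loc s + (- loc _)) class_ofD -mulN1r class_ofM.
  by rewrite rpredD // rpredZ // cs'N //; exact: (N12 _ s'N1).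
- apply: contra sN1 => H; rewrite -[s](subrK (c%:MP * s')) rmorphD class_ofD.
  by rewrite rpredD // cs'N.
move=> a' b' a'q b'q; rewrite ltnS leq_eqVlt => /orP[/eqP a'b'T|lt].
  have [-> ->] : a' = a /\ b' = b.
    by apply: index_injective b'q bq _; rewrite abE.
  by rewrite coef_bipoly_of_subZ /c divfK // subrr.
by rewrite coef_bipoly_of_subZ s0 // s'0 ?abE // mulr0 subrr.
Qed.

(** Upper bound: by [module_initials_proper] the number of initial monomials
    increases along a chain.  Lower bound: the levels jump exactly at the
    positions of the initial monomials, listed in decreasing order. *)
Theorem length_initials (F : realType) :
  mod_length F Q = (#|initials q (bipoly_of g)|%:R%:E : \bar F)%E.
Proof.
set lam := #|_|; apply/eqP; rewrite eq_le; apply/andP; split.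
  apply: ge_ereal_sup => _ [n [N chain] <-]; rewrite lee_fin ler_nat.
  have step i : (i <= n)%N -> (i <= #|module_initials (N i)|)%N.
    elim: i => // i IHi ilt; apply: leq_ltn_trans (IHi (ltnW ilt)) _.
    exact/module_initials_proper/chain.
  apply: leq_trans (step n (leqnn _)) _.
  exact/subset_leq_card/module_initials_sub.
apply: ereal_sup_ubound; exists lam => //.
pose idx (ab : 'I_q * 'I_q) := (ab.1 * q + ab.2)%N.
have idx_lt ab : (idx ab < q * q)%N.
  by rewrite /idx; have := ltn_ord ab.1; have := ltn_ord ab.2; nia.
have idx_inj : injective idx.
  move=> [a b] [a' b'] /(index_injective (ltn_ord b) (ltn_ord b'))[aa' bb'].
  by congr (_, _); apply: val_inj.
pose l := sort leq (map idx (enum (initials q (bipoly_of g)))).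
have size_l : size l = lam by rewrite size_sort size_map -cardE.
have l_sorted : sorted ltn l.
  by rewrite ltn_sorted_uniq_leq sort_uniq (map_inj_uniq idx_inj) enum_uniq sort_sorted //; exact: leq_total.
have lP i : (i < lam)%N -> exists2 ab, ab \in initials q (bipoly_of g) & idx ab = nth 0%N l i.
  rewrite -size_l => /(mem_nth 0%N); rewrite mem_sort => /mapP[ab]; rewrite mem_enum => H ->.
  by exists ab.
(* The chain starts from the last level, which is the zero submodule. *)
pose t i := if i is i'.+1 then nth 0%N l (lam - i) else (q * q)%N.
exists (fun i => (level (t i) : submodClosed Q)) => i ilam.
have [ab abI abE] : exists2 ab, ab \in initials q (bipoly_of g) & idx ab = t i.+1.
  by apply: lP; lia.
have tS : (t i.+1 < t i)%N.
  case: i ilam abE => [|i] ilam abE; first by rewrite -abE; exact: idx_lt.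
  by apply: (sorted_ltn_nth ltn_trans) => //; rewrite ?inE ?size_l; lia.
have ti : (t i <= q * q)%N.
  case: (i) ilam => // i' i'lam; rewrite /t; have [|ab' _ <-] := lP (lam - i'.+1)%N; first lia.
  exact/ltnW/idx_lt.
have tSi := leq_trans (ltnW tS) ti.
split=> [v /=|].
  rewrite -(class_of_surj v) => /(mem_level _ ti) vt; apply/(mem_level _ tSi).
  exact: local_vanishes_le (ltnW tS) vt.
have /initialsP[u [uab u0]] := abI; have [s sE] := bipoly_of_surj u.
rewrite -sE -rmorphM /= -/(idx ab) abE in uab u0.
move/(_ (cls (loc s))) => /= sub; have /sub : cls (loc s) \in level (t i.+1).
  by apply/(mem_level _ tSi); rewrite -rmorphM; apply/local_vanishes_loc.
move/(mem_level _ ti); rewrite -rmorphM => /local_vanishes_loc H.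
case/eqP: uab; apply: H; rewrite ?ltn_ord //.
by rewrite -/(idx ab) abE.
Qed.

End Length.

(** * Products of linear forms *)
Lemma sum_at_most_one (n : nat) (a : 'I_n -> nat) : (forall i, a i <= 1)%N ->
  (forall i j, i != j -> a i = 0%N \/ a j = 0%N) -> (\sum_i a i <= 1)%N.
Proof.
move=> a1 a0; have [[i ai]|no] := pselect (exists i, a i != 0%N); last first.
  rewrite big1 // => i _; apply/eqP; apply: contrapT => /negP ai.
  by apply: no; exists i.
rewrite (bigD1 i) //= big1 ?addn0 ?a1 // => j ji.
by have [//|ai0] := a0 j i ji; rewrite ai0 in ai.
Qed.

Section Forms.
Variable k : fieldType.

Lemma homogenize_prod n (F : 'I_n -> {poly k}) : (forall i, size (F i) <= 2)%N ->
  (size (\prod_i F i)%R <= n.+1)%N /\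
  homogenize n (\prod_i F i) = \prod_i homogenize 1 (F i).
Proof.
elim: n F => [|n IHn] F F2.
  rewrite !big_ord0 size_poly1; split=> //.
  have := @homogenizeX k 0 1 0; rewrite !expr0 => -> //.
  by rewrite size_poly1.
rewrite !big_ord_recr /=.
have [sn <-] := IHn (fun i => F (widen_ord (leqnSn n) i)) (fun i => F2 _).
rewrite homogenizeM // addn1; split=> //.
by have := size_mul_le sn (F2 ord_max); rewrite addn1.
Qed.

Lemma linear_form_homogenize (L : {mpoly k[2]}) : L \is 1.-homog ->
  bipoly_of L = homogenize 1 (graded_part 1 (bipoly_of L)).
Proof.
move=> /dhomogP L1; apply/polyP => a; apply/polyP => b.
rewrite coef_homogenize ?size_poly // coef_graded_part.
case: (eqVneq (a + b)%N 1%N) => [ab|ab]; 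
  first by rewrite ifT; [have -> : (1 - a = b)%N by lia|lia].
rewrite coef_bipoly_of; apply/eqP; apply: contraNT ab.
rewrite -mcoeff_msupp => /L1 deg1; have : mdeg (mnm2 a b) = 1%N := deg1.
by rewrite mdegE big_ord_recl big_ord1 !mnmE /= => ->.
Qed.

Lemma constants_proportional (G H : {poly k}) : (size G <= 1)%N -> (size H <= 1)%N ->
  H != 0 -> exists c, G = c *: H.
Proof.
move=> /size1_polyC -> /size1_polyC ->; rewrite polyC_eq0 => H0.
by exists (G`_0 / H`_0); rewrite -mul_polyC -polyCM divfK.
Qed.

Lemma linear_root (G : {poly k}) x : G != 0 -> (size G <= 2)%N -> (0 < mup x G)%N ->
  exists2 c, c != 0 & G = c *: ('X - x%:P).
Proof.
move=> G0 G2; rewrite -XsubC_dvd // => /dvdpP[h hE].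
have h0 : h != 0 by apply: contraNneq G0 => h0; rewrite hE h0 mul0r.
have h1 : (size h <= 1)%N.
  by move: G2; rewrite hE size_Mmonic ?monicXsubC // size_XsubC addn2.
exists h`_0; last by rewrite {1}hE [h in LHS]size1_polyC // mul_polyC.
by apply: contraNneq h0 => h00; rewrite (size1_polyC h1) h00.
Qed.

(** At most one of the linear factors is constant at y = 1, and at most one
    vanishes at a given point: otherwise two of them would be proportional. *)
Lemma product_of_forms_homogenize r (g : {mpoly k[2]}) : (2 <= r)%N ->
  product_of_forms r g -> exists F : {poly k},
  [/\ bipoly_of g = homogenize r F, (r <= size F <= r.+1)%N
    & forall x, (mup x F <= 1)%N].
Proof.
move=> r2 [L [L1 L_indep ->]].
pose F i := graded_part 1 (bipoly_of (L i)).
have LF i : bipoly_of (L i) = homogenize 1 (F i) by exact: linear_form_homogenize.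
have F2 i : (size (F i) <= 2)%N by exact: size_poly.
have [sF hF] := homogenize_prod F2.
have other (i : 'I_r) : exists j, j != i.
  have [i0|i0] := eqVneq (val i) 0%N.
    by exists (Ordinal r2); rewrite -val_eqE /= i0.
  by exists (Ordinal (ltnW r2)); rewrite -val_eqE /= eq_sym.
have F_indep i j c : i != j -> F i != c *: F j.
  move=> ij; apply: contra (L_indep i j ij c) => /eqP FE; apply/eqP.
  apply: bipoly_of_inj; rewrite LF FE; apply/polyP => a; apply/polyP => b.
  rewrite coef_homogenize ?(leq_trans (size_scale_leq _ _)) //.
  rewrite coef_bipoly_of mcoeffZ -coef_bipoly_of LF coef_homogenize // coefZ.
  by case: ifP; rewrite ?mulr0.
have F0 i : F i != 0.
  have [j ji] := other i; rewrite -(scale0r (F j)).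
  by apply: F_indep; rewrite eq_sym.
exists (\prod_i F i); split.
- by rewrite rmorph_prod hF; apply: eq_bigr => i _; exact: LF.
- rewrite sF andbT size_prod // card_ord.
  have : (\sum_i (2 - size (F i)) <= 1)%N.
    apply: sum_at_most_one => [i|i j ij].
      by have := F0 i; rewrite -size_poly_gt0; lia.
    case: (ltnP 1 (size (F i))) => [Fi|Fi1]; first by left; lia.
    case: (ltnP 1 (size (F j))) => [Fj|Fj1]; first by right; lia.
    have [c Fc] := constants_proportional Fi1 Fj1 (F0 j).
    by have := F_indep i j c ij; rewrite Fc eqxx.
  have -> : (\sum_i (2 - size (F i)) = 2 * r - \sum_i size (F i))%N.
    by rewrite sumnB // sum_nat_const card_ord mulnC.
  have aux S : (2 * r - S <= 1)%N -> (r <= S.+1 - r)%N by lia.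
  exact: aux.
move=> x; have mup_prod : mup x (\prod_i F i) = (\sum_i mup x (F i))%N.
  suff [] : mup x (\prod_i F i) = (\sum_i mup x (F i))%N /\ \prod_i F i != 0 by [].
  apply: (big_ind2 (fun G m => mup x G = m /\ G != 0)).
  - by rewrite oner_eq0 mupNroot // root1.
  - by move=> G1 m1 G2 m2 [<- G10] [<- G20]; rewrite mupM // mulf_neq0.
  - by move=> i _; rewrite F0.
rewrite mup_prod; apply: sum_at_most_one => [i|i j ij].
  by have := mup_leq_size x (F0 i); have := F2 i; lia.
have [mi|mi] := posnP (mup x (F i)); first by left.
have [mj|mj] := posnP (mup x (F j)); first by right.
have [c c0 cE] := linear_root (F0 i) (F2 i) mi.
have [d d0 dE] := linear_root (F0 j) (F2 j) mj.
have := F_indep i j (c / d) ij.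
by rewrite cE dE scalerA divfK // eqxx.
Qed.

Lemma homogenize_initial r (F : {poly k}) : (size F <= r.+1)%N -> F != 0 ->
  exists a0 b0, [/\ (a0 + b0 = r)%N, (homogenize r F)`_a0`_b0 != 0
   & forall a b, (homogenize r F)`_a`_b != 0 ->
     ((a0 < a) || (a0 == a) && (b0 <= b))%N].
Proof.
move=> Fr F0; have exF : exists a, F`_a != 0.
  by exists (size F).-1; rewrite -lead_coefE lead_coef_eq0.
have Fa := ex_minnP exF; case: Fa => a0 Fa0 a0_min.
have a0r : (a0 <= r)%N.
  by rewrite -ltnS (leq_trans _ Fr) // ltnNge; apply: contra Fa0 => /leq_sizeP->.
exists a0, (r - a0)%N; split; first exact: subnKC.
  by rewrite coef_homogenize // subnKC // eqxx.
move=> a b; rewrite coef_homogenize //; case: (eqVneq (a + b)%N r) => [ab /a0_min|]; last by rewrite eqxx.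
lia.
Qed.

End Forms.

(** * Colengths for powers of a product of linear forms *)
Section Counts.
Variables (k : fieldType) (p r : nat).
Hypothesis r2 : (2 <= r)%N.
Variable F : {poly k}.
Hypothesis rF : (r <= size F <= r.+1)%N.
Local Notation f := (homogenize r F).

Definition colength q n := #|initials q (f ^+ n)|.

Lemma colength_step q n :
  (colength q n.+1 <= colength q n <= colength q n.+1 + q * r)%N.
Proof.
have /andP[F1 F2] := rF.
have F0 : F != 0 by rewrite -size_poly_gt0; lia.
have [a0 [b0 [abr ab0 ab_min]]] := homogenize_initial F2 F0.
rewrite /colength exprSr subset_leq_card ?initials_mul_sub //=.
by rewrite -[X in (q * X)%N]abr; exact: card_initials_mul.
Qed.

Lemma colength_lip q n m :
  (colength q (n + m) <= colength q n <= colength q (n + m) + q * r * m)%N.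
Proof.
elim: m => [|m /andP[IH1 IH2]]; first by rewrite addn0 muln0 addn0 leqnn.
have /andP[S1 S2] := colength_step q (n + m); rewrite addnS mulnS; lia.
Qed.

Hypothesis pk : p \in [pchar k].
Hypothesis k_perfect : forall a : k, exists b, b ^+ p = a.

Lemma colength_Frobenius q n : colength (p * q) (p * n) = (p ^ 2 * colength q n)%N.
Proof. by rewrite /colength [(p * n)%N]mulnC exprM (card_initials_Frobenius pk k_perfect). Qed.

Lemma colength_Frobenius_iter e q n :
  colength (p ^ e * q) (p ^ e * n) = (p ^ (2 * e) * colength q n)%N.
Proof.
elim: e => [|e IHe]; first by rewrite muln0 !expn0 !mul1n.
by rewrite expnS -!mulnA colength_Frobenius IHe mulnA -expnD mulnS.
Qed.

Hypothesis F_sqfree : forall x, (mup x F <= 1)%N.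

(** With M = 2 p - r n this is 4 lambda = M^2 + O(p); the defect comes from the
    margin r in [band_neq0]. *)
Lemma colength_prime n : (r * n <= 2 * p)%N ->
  (4 * colength p n <= (2 * p - r * n) ^ 2 <= 4 * colength p n + 4 * r * p)%N.
Proof.
move=> rn; have /andP[F1 F2] := rF.
have Fn : (size (F ^+ n) <= (r * n).+1)%N.
  by apply: leq_trans (size_poly_exp_leq _ _) _; rewrite ltnS leq_mul2r; lia.
rewrite /colength homogenizeX // card_initials_homogeneous_le //=.
pose c := ((2 * p - r * n - r)./2)%N.
have cE := odd_double_half (2 * p - r * n - r); rewrite -/c in cE.
have : (c * c.+1 <= #|initials p (homogenize (r * n) (F ^+ n))|)%N.
  have [->|c_gt0] := posnP c; first by rewrite mul0n.
  apply: card_initials_homogeneous_ge => //; [by lia|by lia|].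
  move=> j jc s s0 sj.
  have [|a [ja ap sa]] := band_neq0 pk k_perfect r2 rF F_sqfree _ s0 sj (n := n).
    by lia.
  by exists a; split=> //; rewrite addnC.
have : (2 * p - r * n <= 2 * c + r.+1)%N by lia.
move: (#|_|) => lam; nia.
Qed.

End Counts.

(** * The normalized lengths and their limit *)
Lemma factor_le1 (R : realFieldType) (x t : R) :
  2 <= x -> 0 <= t -> x * t <= 2 -> t <= 1.
Proof. nra. Qed.

(** Here q stands for p^e, and n, n' for the ceilings of t (q - 1) and
    t (p q - 1). *)
Lemma ceiling_step (R : realFieldType) (p q t n n' : R) :
  2 <= p -> 0 <= t -> t <= 1 ->
  t * (p * q - 1) <= n' -> n' < t * (p * q - 1) + 1 ->
  t * (q - 1) <= n -> n < t * (q - 1) + 1 -> `|n' - p * n| <= 2 * p.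
Proof. by move=> *; rewrite ler_norml; apply/andP; split; nra. Qed.

(** Here q stands for p^e, n for the ceiling of t (p q - 1) and m for the floor of
    t p. *)
Lemma ceiling_floor (R : realFieldType) (p q t m n : R) :
  0 < q -> 0 <= t -> t <= 1 ->
  t * (p * q - 1) <= n -> n < t * (p * q - 1) + 1 ->
  m <= t * p -> t * p < m + 1 -> `|n - q * m| <= q + 2.
Proof. by move=> *; rewrite ler_norml; apply/andP; split; nra. Qed.

Lemma square_near (R : realFieldType) (r p t m : R) :
  0 <= r -> 0 < p -> 0 <= t -> r * t <= 2 -> 0 <= m -> m <= t * p -> t * p < m + 1 ->
  `|(1 - r * m / p / 2) ^+ 2 - (r ^+ 2 / 4 * t ^+ 2 - r * t + 1)| <= r / p.
Proof.
move=> r0 p0 t0 rt m0 mt tm.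
have -> : (1 - r * m / p / 2) ^+ 2 - (r ^+ 2 / 4 * t ^+ 2 - r * t + 1)
    = (t * p - m) * (r / p) * (1 - (r * m / p + r * t) / 4).
  by field; rewrite gt_eqF.
have w0 : 0 <= r / p by rewrite divr_ge0 // ltW.
have -> : r * m / p = r / p * m by rewrite mulrAC.
have wp : r = r / p * p by rewrite divfK // gt_eqF.
rewrite [X in _ * (1 - (_ + X) / _)](_ : _ = r / p * (t * p)); last first.
  by rewrite {1}wp -mulrA [p * t]mulrC.
have rtp : r / p * (t * p) <= 2 by rewrite mulrCA -wp mulrC.
move: (r / p) w0 rtp => w w0 rtp.
have a0 : 0 <= w * m by rewrite mulr_ge0.
have a1 : w * m <= w * (t * p) by rewrite ler_wpM2l.
have a2 : 0 <= 1 - (w * m + w * (t * p)) / 4 <= 1 by apply/andP; split; lra.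
have a3 : 0 <= (t * p - m) * w <= w by apply/andP; split; nra.
case/andP: a2 => a21 a22; case/andP: a3 => a31 a32.
rewrite ger0_norm; last exact: mulr_ge0.
by rewrite -[leRHS]mulr1; apply: ler_pM.
Qed.

Lemma norm_div_le (R : realFieldType) (a r p M : R) : 0 < p ->
  4 * a <= M ^+ 2 -> M ^+ 2 <= 4 * a + 4 * r * p ->
  `|a / p ^+ 2 - (M / p / 2) ^+ 2| <= r / p.
Proof.
move=> p0 lo hi.
have -> : a / p ^+ 2 - (M / p / 2) ^+ 2 = (4 * a - M ^+ 2) / (4 * p ^+ 2).
  by field; rewrite gt_eqF.
have -> : r / p = (4 * r * p) / (4 * p ^+ 2) by field; rewrite gt_eqF.
rewrite normrM [`|_^-1|]gtr0_norm ?invr_gt0 ?mulr_gt0 ?exprn_gt0 //.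
rewrite ler_pM2r ?invr_gt0 ?mulr_gt0 ?exprn_gt0 // ler_norml.
by apply/andP; split; lra.
Qed.

Section Steps.
Variable R : realType.

(** Subtracting the tail 2 C / 2^e turns u into a nondecreasing sequence. *)
Lemma cvgn_halving_steps (u : nat -> R) (C M : R) : 0 <= C ->
  (forall e, `|u e.+1 - u e| <= C * 2^-1 ^+ e) -> (forall e, u e <= M) -> cvgn u.
Proof.
move=> C0 steps uM; pose h e : R := 2 * C * 2^-1 ^+ e.
have h0 e : 0 <= h e by rewrite /h !mulr_ge0 // exprn_ge0 // invr_ge0.
have cvg_h : h @ \oo --> (0 : R).
  by apply: cvg_geometric; rewrite ger0_norm ?invr_ge0 // invf_lt1 // ltr1n.
have cvg_v : cvgn (fun e => u e - h e).
  apply: nondecreasing_is_cvgn; last first.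
    exists M => _ [e _ <-]; have := uM e; have := h0 e; lra.
  apply/nondecreasing_seqP => e.
  have := steps e; rewrite ler_norml => /andP[lo _].
  have -> : h e.+1 = C * 2^-1 ^+ e by rewrite /h exprS; field.
  rewrite /h; lra.
have -> : u = (fun e => (u e - h e) + h e) by apply/funext => e; rewrite subrK.
by apply: is_cvgD => //; apply/cvg_ex; exists 0.
Qed.

Lemma lim_distance_le (u : nat -> R) (P B D : R) : cvgn u ->
  (forall e, `|u e.+1 - P| <= B + D * 2^-1 ^+ e) -> `|limn u - P| <= B.
Proof.
move=> cvg_u uB.
have lhs : (fun e => `|u e.+1 - P|) @ \oo --> `|limn u - P|.
  apply: cvg_norm; apply: cvgB; last exact: cvg_cst.
  by rewrite cvg_shiftS.
have rhs : (fun e => B + D * 2^-1 ^+ e) @ \oo --> B.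
  rewrite -[X in _ --> X]addr0; apply: cvgD; first exact: cvg_cst.
  by apply: cvg_geometric; rewrite ger0_norm ?invr_ge0 // invf_lt1 // ltr1n.
by apply: ler_cvg_to lhs rhs _; apply: nearW => e.
Qed.

Lemma ceil_exponent_bounds p (t : R) e : 0 <= t -> (0 < p)%N ->
  t * (p%:R ^+ e - 1) <= (ceil_exponent p t e)%:R < t * (p%:R ^+ e - 1) + 1.
Proof.
move=> t0 p0; set x := t * _.
have x0 : 0 <= x by rewrite mulr_ge0 // subr_ge0 exprn_ege1 // ler1n.
have c0 : (0 <= Num.ceil x)%R by rewrite ceil_ge0; lra.
have -> : (ceil_exponent p t e)%:R = (Num.ceil x)%:~R :> R.
  by rewrite -[in RHS](gez0_abs c0).
have := ceil_itv x; lra.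
Qed.

Variables (k : fieldType) (p r : nat).
Hypothesis r2 : (2 <= r)%N.
Variable F : {poly k}.
Hypothesis rF : (r <= size F <= r.+1)%N.
Local Notation len := (colength r F).

Lemma colength_lip_real q a b :
  `|(len q a)%:R - (len q b)%:R| <= q%:R * r%:R * `|a%:R - b%:R| :> R.
Proof.
have key n m : `|(len q n)%:R - (len q (n + m))%:R| <= q%:R * r%:R * m%:R :> R.
  have /andP[lo hi] := colength_lip r2 rF q n m.
  rewrite ger0_norm ?subr_ge0 ?ler_nat // lerBlDl.
  by rewrite -!natrM -natrD ler_nat.
have [ab|/ltnW ba] := leqP a b.
  rewrite -(subnKC ab) (le_trans (key _ _)) // natrD opprD addrA subrr add0r normrN.
  by rewrite normr_nat.
rewrite distrC -(subnKC ba) (le_trans (key _ _)) //.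
by rewrite natrD addrAC subrr add0r normr_nat.
Qed.

Hypothesis pk : p \in [pchar k].
Hypothesis k_perfect : forall a : k, exists b, b ^+ p = a.

Lemma colength_scale e q n :
  (len (p ^ e * q) (p ^ e * n))%:R / (p ^ e * q)%:R ^+ 2 = (len q n)%:R / q%:R ^+ 2 :> R.
Proof.
have p0 : p%:R != 0 :> R by rewrite pnatr_eq0 -lt0n prime_gt0 // (pcharf_prime pk).
rewrite (colength_Frobenius_iter r F pk k_perfect) !natrM !natrX exprMn.
have pe0 : p%:R ^+ e != 0 :> R by rewrite expf_neq0.
rewrite [(2 * e)%N]mulnC exprM -mulf_div. by rewrite divff ?mul1r // expf_neq0.
Qed.

Variable t : R.
Hypothesis t_ge0 : 0 <= t.
Hypothesis t_le : r%:R * t <= 2.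

Definition normalized_length e : R :=
  (len (p ^ e) (ceil_exponent p t e))%:R / (p ^ e)%:R ^+ 2.

Lemma p_ge2 : 2%:R <= p%:R :> R.
Proof. by rewrite ler_nat prime_gt1 // (pcharf_prime pk). Qed.
Lemma p_gt0 : 0 < p%:R :> R. Proof. exact: lt_le_trans p_ge2. Qed.
Lemma pe_gt0 e : 0 < p%:R ^+ e :> R. Proof. exact/exprn_gt0/p_gt0. Qed.
Lemma t_le1 : t <= 1.
Proof.
by apply: factor_le1 t_ge0 t_le; rewrite ler_nat.
Qed.
Lemma pe_inv e : (p%:R ^+ e)^-1 <= 2^-1 ^+ e :> R.
Proof.
by rewrite -exprVn lerXn2r ?nnegrE ?invr_ge0 ?ler0n // lef_pV2 ?posrE ?p_gt0 ?p_ge2.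
Qed.

Lemma normalized_length_le1 e : normalized_length e <= 1.
Proof.
rewrite ler_pdivrMr; last by rewrite exprn_gt0 // natrX pe_gt0.
rewrite mul1r expr2 -natrM ler_nat.
exact: card_initials_le.
Qed.

Lemma colength_lip_normalized q a b : (0 < q)%N ->
  `|(len q a)%:R / q%:R ^+ 2 - (len q b)%:R / q%:R ^+ 2|
    <= r%:R * `|a%:R - b%:R| / q%:R :> R.
Proof.
move=> q0; have q0' : 0 < q%:R :> R by rewrite ltr0n.
rewrite -mulrBl normrM [`|_^-1|]gtr0_norm ?invr_gt0 ?exprn_gt0 //.
rewrite ler_pdivrMr ?exprn_gt0 // (le_trans (colength_lip_real _ _ _)) //.
rewrite le_eqVlt; apply/orP; left; apply/eqP; field; lra.
Qed.

(** By the scaling under Frobenius both terms can be taken at level p^(e+1), where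
    the exponents differ by O(p). *)
Lemma normalized_length_step e :
  `|normalized_length e.+1 - normalized_length e| <= 2 * r%:R * 2^-1 ^+ e.
Proof.
have p0 := p_gt0; have pe0 := pe_gt0 e.
rewrite /normalized_length -[X in _ - X](colength_scale 1) expn1 -expnS.
apply: le_trans (colength_lip_normalized _ _ _) _.
  by rewrite expn_gt0 prime_gt0 // (pcharf_prime pk).
have := ceil_exponent_bounds e t_ge0 (prime_gt0 (pcharf_prime pk)).
have := ceil_exponent_bounds e.+1 t_ge0 (prime_gt0 (pcharf_prime pk)).
set N' := (ceil_exponent p t e.+1)%:R; set N := ceil_exponent p t e.
rewrite natrM exprS => /andP[N'1 N'2] /andP[N1 N2].
have -> : (p ^ e.+1)%:R = p%:R * p%:R ^+ e :> R by rewrite natrX exprS.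
have dist : `|N' - p%:R * N%:R| <= 2 * p%:R.
  exact: ceiling_step p_ge2 t_ge0 t_le1 N'1 N'2 N1 N2.
apply: le_trans (_ : r%:R * (2 * p%:R) / (p%:R * p%:R ^+ e) <= _).
  by rewrite ler_pM2r ?invr_gt0 ?mulr_gt0 // ler_wpM2l.
have -> : r%:R * (2 * p%:R) / (p%:R * p%:R ^+ e) = 2 * r%:R * (p%:R ^+ e)^-1 :> R.
  by field; rewrite !gt_eqF.
by rewrite ler_wpM2l ?pe_inv // mulr_ge0.
Qed.

Lemma cvg_normalized_length : cvgn normalized_length.
Proof.
apply: (@cvgn_halving_steps _ (2 * r%:R) 1); first by rewrite mulr_ge0.
  exact: normalized_length_step.
exact: normalized_length_le1.
Qed.

Hypothesis F_sqfree : forall x, (mup x F <= 1)%N.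

Lemma prime_level n : (r * n <= 2 * p)%N ->
  `|(len p n)%:R / p%:R ^+ 2 - (1 - r%:R * n%:R / p%:R / 2) ^+ 2| <= r%:R / p%:R :> R.
Proof.
have p0 := p_gt0; move=> rn; have /andP[] := colength_prime r2 rF pk k_perfect F_sqfree rn.
rewrite -!(ler_nat R) natrD !natrX !natrM natrB // !natrM => lo hi.
have -> : 1 - r%:R * n%:R / p%:R / 2 = (2 * p%:R - r%:R * n%:R) / p%:R / 2 :> R.
  by field; rewrite gt_eqF.
exact: norm_div_le.
Qed.

(** Compare with level p: the exponent N is within p^e + 2 of p^e n, where n is the
    floor of t p. *)
Lemma normalized_length_near e :
  `|normalized_length e.+1 - (r%:R ^+ 2 / 4 * t ^+ 2 - r%:R * t + 1)|
    <= 3 * r%:R / p%:R + 2 * r%:R * 2^-1 ^+ e.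
Proof.
have p0 := p_gt0; have pe0 := pe_gt0 e; have r0 : 0 <= r%:R :> R by [].
have tp0 : 0 <= t * p%:R by rewrite mulr_ge0.
pose n := Num.trunc (t * p%:R); have /andP[n1 n2] := trunc_itv tp0.
rewrite -/n -natr1 in n1 n2.
have rn : (r * n <= 2 * p)%N.
  rewrite -(ler_nat R) !natrM; have /= := ler_wpM2l r0 n1.
  have /= := ler_wpM2r (ltW p_gt0) t_le; lra.
have far : `|normalized_length e.+1 - (len p n)%:R / p%:R ^+ 2| <=
    r%:R / p%:R + 2 * r%:R * 2^-1 ^+ e.
  rewrite -(colength_scale e) /normalized_length -expnSr.
  apply: le_trans (colength_lip_normalized _ _ _) _.
    by rewrite expn_gt0 prime_gt0 // (pcharf_prime pk).
  have := ceil_exponent_bounds e.+1 t_ge0 (prime_gt0 (pcharf_prime pk)).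
  set N := (ceil_exponent p t e.+1)%:R.
  rewrite natrM !natrX exprS => /andP[N1 N2].
  have dist : `|N - p%:R ^+ e * n%:R| <= p%:R ^+ e + 2.
    exact: ceiling_floor pe0 t_ge0 t_le1 N1 N2 n1 n2.
  apply: le_trans (_ : r%:R * (p%:R ^+ e + 2) / (p%:R * p%:R ^+ e) <= _).
    by rewrite ler_pM2r ?invr_gt0 ?mulr_gt0 // ler_wpM2l.
  have -> : r%:R * (p%:R ^+ e + 2) / (p%:R * p%:R ^+ e) =
     r%:R / p%:R + 2 / p%:R * r%:R * (p%:R ^+ e)^-1 :> R.
    by field; rewrite !gt_eqF.
  rewrite lerD2l; apply: ler_pM; rewrite ?pe_inv ?mulr_ge0 ?invr_ge0 ?exprn_ge0 ?(ltW p0) //.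
  by rewrite ler_wpM2r // ler_pdivrMr //; have := p_ge2; lra.
have near_t : `|(1 - r%:R * n%:R / p%:R / 2) ^+ 2 -
    (r%:R ^+ 2 / 4 * t ^+ 2 - r%:R * t + 1)| <= r%:R / p%:R.
  exact: square_near.
have := prime_level rn; move: far near_t.
set a := normalized_length _; set b := _ / _ ^+ 2; set c := (1 - _) ^+ 2.
set d := (_ + 1); set h := 2 * _ * _.
have -> : 3 * r%:R / p%:R = 3 * (r%:R / p%:R) :> R by rewrite mulrA.
set s := r%:R / p%:R.
rewrite !ler_norml; lra.
Qed.

Lemma lim_normalized_length :
  `|limn normalized_length - (r%:R ^+ 2 / 4 * t ^+ 2 - r%:R * t + 1)| <= 3 * r%:R / p%:R.
Proof.
apply: lim_distance_le cvg_normalized_length _ => e; exact: normalized_length_near.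
Qed.

End Steps.

(** * Bounds on the F-pure threshold *)
Lemma box_degree (F : realFieldType) (t r q N a b : F) :
  2 < t * r -> 1 < q -> 0 < r -> t * (q - 1) <= N -> a <= q - 1 -> b <= q - 1 ->
  a + b < r * N.
Proof.
move=> tr q1 r0 tN aq bq.
have rN : r * (t * (q - 1)) <= r * N by rewrite ler_wpM2l // ltW.
have : 0 < (t * r - 2) * (q - 1) by rewrite mulr_gt0 // subr_gt0.
nra.
Qed.

(** The forms x + i y with i < r are pairwise non-proportional if r <= p. *)
Lemma forms_exist (k : fieldType) p r : p \in [pchar k] -> (r <= p)%N ->
  exists g : {mpoly k[2]}, product_of_forms r g.
Proof.
move=> pk rp; pose L (i : 'I_r) : {mpoly k[2]} := 'X_ord0 + i%:R *: 'X_(lift ord0 ord0).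
exists (\prod_i L i), L; split=> // [i|i j ij c].
  by rewrite rpredD ?rpredZ // dhomogX; apply/eqP; exact: mdeg1.
apply/eqP => Lij.
have coefL (l : 'I_r) : (L l)@_U_(ord0) = 1 /\ (L l)@_U_(lift ord0 ord0) = l%:R.
  by rewrite /L !mcoeffD !mcoeffZ !mcoeffX !eqxx /= !eq_mnm1 /= ?mulr0 ?mulr1 ?addr0 ?add0r.
have [Li0 Li1] := coefL i; have [Lj0 Lj1] := coefL j.
have c1 : c = 1.
  by have := congr1 (mcoeff U_(ord0)) Lij; rewrite Li0 mcoeffZ Lj0 mulr1.
have eq_ij : i%:R = j%:R :> k.
  by have := congr1 (mcoeff U_(lift ord0 ord0)) Lij; rewrite c1 scale1r Li1 Lj1.
have no a b : (a < b)%N -> (b < r)%N -> a%:R = b%:R :> k -> False.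
  move=> ab br /esym/eqP; rewrite -subr_eq0 -natrB ?(ltnW ab) // -(dvdn_pcharf pk).
  by rewrite gtnNdvd ?subn_gt0 //; lia.
case: (ltngtP i j) => [lt|lt|/val_inj eij]; last by rewrite eij eqxx in ij.
  exact: no lt (ltn_ord j) eq_ij.
exact: no lt (ltn_ord i) (esym eq_ij).
Qed.

Section Splitting.
Variables (k : fieldType) (p : nat).
Hypothesis pk : p \in [pchar k].
Hypothesis k_perfect : forall a : k, exists b, b ^+ p = a.
Local Notation R := (plane_local_ring k).
Local Notation loc := (@plane_local k).

Lemma mpoly_cartier : exists C : {mpoly k[2]} -> {mpoly k[2]},
  [/\ forall a b, C (a + b) = C a + C b, forall a b, C (a * b ^+ p) = C a * b & C 1 = 1].
Proof.
have p_gt0 : (0 < p)%N by rewrite prime_gt0 // (pcharf_prime pk).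
pose ct := cartier k_perfect 0 0.
have /choice[C CE] : forall a : {mpoly k[2]}, exists c, bipoly_of c = ct (bipoly_of a).
  by move=> a; exact: bipoly_of_surj.
exists C; split=> [a b|a b|]; apply: bipoly_of_inj.
- by rewrite rmorphD /= !CE rmorphD /=; exact: (cartierD pk k_perfect 0 0 _ _).
- rewrite rmorphM /= !CE rmorphM rmorphXn /=.
  exact: (cartierM pk k_perfect _ _ p_gt0 p_gt0).
rewrite CE rmorph1; apply/polyP => a; apply/polyP => b; rewrite coef_cartier // !addn0.
apply: (proot_inj pk); rewrite prootK !coef1 muln_eq0 eqn0Ngt p_gt0 /=.
case: a => [|a] /=; last by rewrite !coef0 expr0n eqn0Ngt p_gt0.
rewrite !coef1 muln_eq0 eqn0Ngt p_gt0 /=.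
by case: b => [|b] /=; rewrite ?expr1n // expr0n eqn0Ngt p_gt0.
Qed.

(** The Cartier operator C of k[x,y] extends to fractions by
    a / b = a b^(p-1) / b^p, which is sent to C (a b^(p-1)) / b. *)
Lemma Frobenius_splitting : exists phi : R -> R,
  [/\ forall a b, phi (a + b) = phi a + phi b,
      forall a b, phi (a ^+ p * b) = a * phi b & phi 1 = 1].
Proof.
have p_gt0 : (0 < p)%N by rewrite prime_gt0 // (pcharf_prime pk).
have [C [CD CM C1]] := mpoly_cartier.
have cancel_loc b (z w : R) : (bipoly_of b)`_0`_0 != 0 -> z * loc b = w * loc b -> z = w.
  by move=> /plane_local_unit[v vb] e; rewrite -[z]mulr1 -[w]mulr1 -vb mulrCA e mulrCA.
have /choice[phi phiE] (z : R) : exists w, exists a b, fraction_of z a b /\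
    w * loc b = loc (C (a * b ^+ p.-1)).
  have [a [b zab]] := fraction_exists z; have [v vb] := plane_local_unit zab.1.
  exists (v * loc (C (a * b ^+ p.-1))), a, b; split=> //.
  by rewrite mulrAC vb mul1r.
have pS (b : {mpoly k[2]}) : b ^+ p.-1 * b = b ^+ p by rewrite -exprSr prednK.
have phi_frac z a b : fraction_of z a b -> phi z * loc b = loc (C (a * b ^+ p.-1)).
  move=> [b0 zb]; have [a' [b' [[b'0 zb'] phiz]]] := phiE z.
  have ab : a * b' = a' * b.
    by apply: plane_local_inj; rewrite !rmorphM /= -zb -zb' mulrAC.
  apply: (cancel_loc b' _ _ b'0); rewrite mulrAC phiz -!rmorphM -!CM; congr (loc (C _)).
  by rewrite -!pS; ring: ab.
exists phi; split.
- move=> z w; have [a [b zab]] := fraction_exists z; have [c [d wcd]] := fraction_exists w.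
  have bd := fraction_ofD zab wcd.
  apply: (cancel_loc _ _ _ bd.1); rewrite (phi_frac _ _ _ bd).
  have -> : (phi z + phi w) * loc (b * d) =
      loc (C (a * b ^+ p.-1) * d + C (c * d ^+ p.-1) * b).
    rewrite rmorphD !rmorphM /= -(phi_frac _ _ _ zab) -(phi_frac _ _ _ wcd).
    by ring.
  rewrite -!CM -CD; congr (loc (C _)).
  by rewrite -!pS !exprMn; ring.
- move=> x z; have [a [b zab]] := fraction_exists z; have [c [d xcd]] := fraction_exists x.
  have H := fraction_ofM (fraction_ofX p xcd) zab.
  apply: (cancel_loc _ _ _ H.1); rewrite (phi_frac _ _ _ H).
  have -> : x * phi z * loc (d ^+ p * b) = loc (C (a * b ^+ p.-1) * (c * d ^+ p.-1)).
    rewrite !rmorphM /= -(phi_frac _ _ _ zab) -xcd.2 -pS rmorphM /=.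
    ring.
  by rewrite -CM; congr (loc (C _)); rewrite !exprMn -!exprM [(p.-1 * p)%N]mulnC; ring.
have one := fraction_of_loc (1 : {mpoly k[2]}).
have := phi_frac _ _ _ one; rewrite rmorph1 mulr1 expr1n mulr1 C1 rmorph1.
by [].
Qed.

(** The splitting of Frobenius makes the pair F-pure for t = 0. *)
Lemma Fpure_threshold_ge0 (F : realType) (f : R) : (0 <= Fpure_threshold F p f)%E.
Proof.
apply: ereal_sup_ubound; exists 0 => //; split=> //=.
exists 1%N => //; have [phi [phiD phiM phi1]] := Frobenius_splitting.
exists phi; split=> //.
by rewrite /ceil_exponent mul0r ceil0 expr0.
Qed.

Lemma not_local_vanishes1 : ~ local_vanishes 1 1 (1 : R).
Proof.
rewrite -(rmorph1 loc) => /local_vanishes_loc/(_ 0%N 0%N isT isT isT)/eqP.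
by rewrite rmorph1 !coef1 oner_eq0.
Qed.

(** If t > 2 / r then f^N has degree r N > 2 q - 2, so it is in m^[q]; a
    p^(-e)-linear map sends m^[q] into m and cannot take the value 1 there. *)
Lemma Fpure_threshold_le (F : realType) r (g : {mpoly k[2]}) (G : {poly k}) :
  (0 < r)%N -> bipoly_of g = homogenize r G -> (size G <= r.+1)%N ->
  (Fpure_threshold F p (plane_local g) <= (2 / r%:R)%:E)%E.
Proof.
move=> r_gt0 gG Gr; apply: ge_ereal_sup => _ [t [/= t0 [e e_gt0 [phi [phiD phiM phi1]]]] <-].
have p_gt1 : (1 < p)%N by rewrite prime_gt1 // (pcharf_prime pk).
rewrite lee_fin ler_pdivlMr ?ltr0n // leNgt; apply/negP => rt.
apply: not_local_vanishes1; rewrite -phi1; set N := ceil_exponent _ _ _.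
have : plane_local g ^+ N \in frobenius_power (@plane_max_ideal k) (p ^ e).
  apply/(frobenius_powerP pk); rewrite -rmorphXn; apply/local_vanishes_loc.
  rewrite rmorphXn /= gG homogenizeX // => a b aq bq _.
  rewrite coef_homogenize; last first.
    by apply: leq_trans (size_poly_exp_leq _ _) _; rewrite ltnS leq_mul2r; lia.
  rewrite ifF //; apply/negbTE; rewrite neq_ltn; apply/orP; left.
  rewrite -(ltr_nat F) natrD natrM.
  have /andP[xN _] := ceil_exponent_bounds e t0 (ltnW p_gt1).
  apply: box_degree rt _ _ xN _ _; rewrite ?ltr0n //.
  - by rewrite -natrX ltr1n -(exp1n e) ltn_exp2r.
  - by rewrite lerBrDr natr1 -natrX ler_nat.
  - by rewrite lerBrDr natr1 -natrX ler_nat.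
case/asboolP => n [c [h [hX ->]]].
have phi_at0 : phi 0 = 0 by apply: (addrI (phi 0)); rewrite -phiD !addr0.
rewrite (big_morph phi phiD phi_at0).
apply: (big_ind (local_vanishes 1 1)); [exact: local_vanishes0|exact: local_vanishesD|].
move=> i _; have [x xm <-] := hX i; rewrite mulrC phiM mulrC.
by apply: local_vanishesM; apply/plane_max_idealP.
Qed.

End Splitting.

(** * Uniform convergence *)
Lemma Fsignature_near (R : realType) (k : fieldType) p r (g : {mpoly k[2]}) (t : R) :
  perfect_in_char k p -> (2 <= r)%N -> product_of_forms r g ->
  0 <= t -> r%:R * t <= 2 ->
  (`|Fsignature p 2 (@plane_max_ideal k) (plane_local g) t -
      (r%:R ^+ 2 / 4 * t ^+ 2 - r%:R * t + 1)%:E| <= (3 * r%:R / p%:R)%:E)%E.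
Proof.
move=> [pk k_perfect] r2 g_forms t0 rt.
have [F [gF rF F_sqfree]] := product_of_forms_homogenize r2 g_forms.
have cvg_u := cvg_normalized_length r2 rF pk k_perfect t0 rt.
have near_u := lim_normalized_length r2 rF pk k_perfect t0 rt F_sqfree.
suff -> : Fsignature p 2 (@plane_max_ideal k) (plane_local g) t =
    (limn (normalized_length p r F t))%:E.
  by rewrite -EFinB abse_EFin lee_fin.
apply/cvg_lim => //; rewrite [X in X @ _](_ : _ = EFin \o normalized_length p r F t).
  by apply: cvg_EFin; [exact: nearW|exact: cvg_u].
apply/funext => e /=.
rewrite -rmorphXn (length_initials pk) rmorphXn /= gF.
rewrite -EFinM /normalized_length /colength natrX exprM.
by [].
Qed.

Theorem theorem3p1 (R : realType) (r : nat) (k : nat -> fieldType)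
    (f : forall p : nat, {mpoly (k p)[2]}) :
  (2 <= r)%N ->
  (forall p : nat, prime p -> perfect_in_char (k p) p) ->
  (forall p : nat, prime p ->
     (exists g : {mpoly (k p)[2]}, product_of_forms r g) ->
     product_of_forms r (f p)) ->
  ereal_sup
    [set `| Fsignature p 2 (plane_max_ideal (k p)) (plane_local (f p)) t
            - (r%:R ^+ 2 / 4 * t ^+ 2 - r%:R * t + 1)%:E |%E
     | t in [set t : R | 0 <= t /\
              (t%:E <= Fpure_threshold R p (plane_local (f p)))%E]]
    @[p --> within [set p | prime p] \oo] --> 0%E.
Proof.
move=> r2 k_perf f_forms.
apply: (@squeeze_cvge _ _ _ _ (fun=> 0%E) _ (fun p => (3 * r%:R / p%:R)%:E)).
- near=> p.
  have p_prime : prime p by near: p; exact: withinT.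
  have rp : (r <= p)%N by near: p; apply: cvg_within; exact: nbhs_infty_ge.
  have [pk perf] := k_perf p p_prime.
  have fp := f_forms p p_prime (forms_exist pk rp).
  have [F [gF rF _]] := product_of_forms_homogenize r2 fp.
  have rt t : (t%:E <= Fpure_threshold R p (plane_local (f p)))%E -> r%:R * t <= 2.
    move=> /le_trans/(_ (Fpure_threshold_le pk R (ltnW r2) gF _)).
    have /andP[_ -> /(_ isT)] := rF.
    by rewrite lee_fin ler_pdivlMr ?ltr0n ?(ltnW r2) // mulrC.
  apply/andP; split.
    apply: le_trans (abse_ge0 _) (ereal_sup_ubound _); exists 0 => //=.
    by split=> //; exact: Fpure_threshold_ge0.
  apply: ge_ereal_sup => _ [t [t0 tF] <-].
  exact: Fsignature_near (conj pk perf) r2 fp t0 (rt t tF).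
- exact: cvg_cst.
have cvg0 : (fun p : nat => 3 * r%:R / p%:R : R) @ \oo --> 3 * r%:R * (0 : R).
  by apply: cvgM; [exact: cvg_cst|rewrite -cvg_shiftS; exact: cvg_harmonic].
rewrite mulr0 in cvg0; apply: cvg_EFin; first exact: nearW.
by apply: cvg_trans cvg0; apply: cvg_app; exact: cvg_within.
Unshelve. all: by end_near.
Qed.
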